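(* Let $\mathbb{CP}^2$ be the complex projective plane, equipped with the standard Fubini-Study metric $g_{FS}$. Then $(\mathbb{CP}^2, g_{FS})$ admits no orthogonal system of coordinates; that is, there is no non-empty open subset $\mathcal{U} \subset \mathbb{CP}^2$ carrying a system of orthogonal coordinates for $g_{FS}$.
   Context: Let $(M,g)$ be a Riemannian manifold of dimension $n$. A system of (real, smooth) local coordinates $x_1, \ldots, x_n$ defined on an open set $\mathcal{U} \subset M$ is called orthogonal if $g\left(\frac{\partial}{\partial x_i}, \frac{\partial}{\partial x_j}\right) = 0$ on $\mathcal{U}$ whenever $i \neq j$, i.e. if on $\mathcal{U}$ the metric has the form $g = \sum_{j=1}^n a_j^2\, dx_j \otimes dx_j$ for some positive functions $a_1, \ldots, a_n$ on $\mathcal{U}$. The Fubini-Study metric $g_{FS}$ on $\mathbb{CP}^2$ (a real manifold of dimension $n = 4$) is the standard Kähler metric of constant holomorphic sectional curvature $c > 0$; up to a positive constant factor it is the metric making the Hopf fibration $\mathbb{S}^{5} \to \mathbb{CP}^2$ from the round unit sphere a Riemannian submersion. With $J$ the complex structure of $\mathbb{CP}^2$, $\omega = g_{FS}(J\cdot, \cdot)$ the Kähler form, and the sign convention $R_{X,Y}Z = \nabla_{[X,Y]}Z - \nabla_X(\nabla_Y Z) + \nabla_Y(\nabla_X Z)$ ($\nabla$ being the Levi-Civita connection), its curvature is $$R^{FS}_{X,Y}Z = \frac{c}{4}\big(g_{FS}(X,Z)\,Y - g_{FS}(Y,Z)\,X + \omega(X,Z)\,JY - \omega(Y,Z)\,JX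 + 2\omega(X,Y)\,JZ\big).$$ *)

(* Defs.v *)
From HB Require Import structures.
From mathcomp Require Import all_boot all_order all_algebra.
From mathcomp Require Import all_classical all_reals all_analysis.
From mathcomp Require Import complex.
Import Order.TTheory GRing.Theory Num.Theory numFieldNormedType.Exports.

Set Implicit Arguments.
Unset Strict Implicit.
Unset Printing Implicit Defensive.

Local Open Scope classical_set_scope.
Local Open Scope ring_scope.
Local Open Scope quotient_scope.

(* Meant for open [U] only: [differentiable] and ['D_v f] are not relative
   to [U]. *)
Fixpoint is_Ck (R : realType) (V W : normedModType R) (k : nat)
    (U : set V) (f : V -> W) : Prop :=
  if k is k'.+1 then
    (forall x, U x -> differentiable f x) /\
    (forall v, is_Ck k' U ('D_v f))
  else forall x, U x -> {for x, continuous f}.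

Definition smooth_on (R : realType) (V W : normedModType R)
    (U : set V) (f : V -> W) : Prop :=
  forall k, is_Ck k U f.

Section Manifolds.
Variables (R : realType) (m : nat) (M : topologicalType).

(* Only the values of [chart_map] on [chart_dom] and of [chart_inv] on
   [chart_im] are meaningful. *)
Record chart := Chart {
  chart_dom : set M;
  chart_map : M -> 'rV[R]_m;
  chart_inv : 'rV[R]_m -> M }.

Definition chart_im (x : chart) : set 'rV[R]_m := chart_map x @` chart_dom x.

Definition is_chart (x : chart) : Prop :=
  [/\ open (chart_dom x), open (chart_im x),
      {in chart_dom x, cancel (chart_map x) (chart_inv x)},
      {within chart_dom x, continuous (chart_map x)} &
      {within chart_im x, continuous (chart_inv x)}].

Definition smooth_transition (x y : chart) : Prop :=
  smooth_on (chart_map x @` (chart_dom x `&` chart_dom y))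
    (chart_map y \o chart_inv x).

Variables (I : Type) (atlas : I -> chart).

Definition local_coordinates (x : chart) : Prop :=
  is_chart x /\
  forall k, smooth_transition x (atlas k) /\ smooth_transition (atlas k) x.

(* The tangent vector d/dx_i at [p], expressed in the chart [atlas k]. *)
Definition coord_vector (k : I) (x : chart) (i : 'I_m) (p : M) : 'rV[R]_m :=
  'D_(delta_mx 0 i) (chart_map (atlas k) \o chart_inv x) (chart_map x p).

(* [g k p u v] is the metric at [p], applied to the tangent vectors whose
   expressions in the chart [atlas k] are [u] and [v]. *)
Variable g : I -> M -> 'rV[R]_m -> 'rV[R]_m -> R.

Definition orthogonal_coordinates (x : chart) : Prop :=
  local_coordinates x /\
  forall (k : I) (p : M), chart_dom x p -> chart_dom (atlas k) p ->
  forall i j : 'I_m, i != j ->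
    g k p (coord_vector k x i p) (coord_vector k x j p) = 0.

End Manifolds.

(* [R[i]] as a [numClosedFieldType], so that row vectors over it inherit the
   topology of the norm. *)
Definition Cplx (R : realType) : numClosedFieldType := R[i]%C.

Section ProjectiveSpace.
Variables (R : realType) (n : nat).
Local Notation C := (Cplx R).

Definition nonzero_vec : topologicalType :=
  set_type [set z : 'rV[C]_n.+1 | z != 0].

Definition collinear (u v : nonzero_vec) : bool :=
  `[< exists2 l : C, l != 0 & set_val u = l *: set_val v >].

Lemma collinear_refl : reflexive collinear.
Proof. by move=> u; apply/asboolP; exists 1; rewrite ?oner_eq0 ?scale1r. Qed.

Lemma collinear_sym : symmetric collinear.
Proof.
suff H u v : collinear u v -> collinear v u by move=> u v; apply/idP/idP; exact: H.
move=> /asboolP[l l0 uv]; apply/asboolP; exists l^-1; first by rewrite invr_eq0.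
by rewrite uv scalerA mulVf // scale1r.
Qed.

Lemma collinear_trans : transitive collinear.
Proof.
move=> v u w /asboolP[l l0 uv] /asboolP[l' l'0 vw]; apply/asboolP.
by exists (l * l'); rewrite ?mulf_neq0 // uv vw scalerA.
Qed.

Canonical collinear_equiv :=
  EquivRel collinear collinear_refl collinear_sym collinear_trans.

Definition CP : topologicalType :=
  quotient_topology {eq_quot collinear_equiv}.

Definition hcoord (p : CP) : 'rV[C]_n.+1 := set_val (repr p : nonzero_vec).

Definition insert_entry (k : 'I_n.+1) (a : C) (w : 'rV[C]_n) : 'rV[C]_n.+1 :=
  \row_j oapp (w 0) a (unlift k j).

Definition realify (w : 'rV[C]_n) : 'rV[R]_(n + n) :=
  row_mx (map_mx (@complex.Re R) w) (map_mx (@complex.Im R) w).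

Definition complexify (u : 'rV[R]_(n + n)) : 'rV[C]_n :=
  \row_j (lsubmx u 0 j +i* rsubmx u 0 j)%C.

Lemma insert1_neq0 (k : 'I_n.+1) (w : 'rV[C]_n) : insert_entry k 1 w != 0.
Proof.
apply/eqP => /rowP /(_ k); rewrite !mxE unlift_none /= => /eqP.
by rewrite oner_eq0.
Qed.

Definition affine_vec (k : 'I_n.+1) (w : 'rV[C]_n) : nonzero_vec :=
  exist (fun z => z \in [set z : 'rV[C]_n.+1 | z != 0])
    (insert_entry k 1 w) (mem_set (insert1_neq0 k w)).

Definition affine_chart (k : 'I_n.+1) : chart R (n + n) CP := {|
  chart_dom := [set p | hcoord p 0 k != 0];
  chart_map := fun p =>
    realify (\row_j (hcoord p 0 (lift k j) / hcoord p 0 k));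
  chart_inv := fun u => \pi_CP (affine_vec k (complexify u)) |}.

Definition hdot (u v : 'rV[C]_n.+1) : C := \sum_j u 0 j * (v 0 j)^*.

(* Orthogonal projection onto the Hermitian complement of the line [C z]. *)
Definition horizontal (z u : 'rV[C]_n.+1) : 'rV[C]_n.+1 :=
  u - (hdot u z / hdot z z) *: z.

(* Scalar product of the images of [u] and [v] under the differential at [z]
   of the projection of C^(n+1) \ 0 onto [CP], for the metric that makes the
   Hopf fibration of the unit sphere a Riemannian submersion: that projection
   factors through [z / |z|], where the horizontal lifts of the images of
   [u] and [v] are [horizontal z u / |z|] and [horizontal z v / |z|]. *)
Definition hopf_metric (z u v : 'rV[C]_n.+1) : R :=
  complex.Re (hdot (horizontal z u) (horizontal z v) / hdot z z).

(* The metric of constant holomorphic sectional curvature [c]; the quotient of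
   the unit sphere has holomorphic sectional curvature 4.  In the chart of
   index [k], the local section [insert_entry k 1] of the projection onto [CP]
   has differential [insert_entry k 0]. *)
Definition fubini_study (c : R) (k : 'I_n.+1) (p : CP) (u v : 'rV[R]_(n + n)) : R :=
  4 / c *
  hopf_metric (insert_entry k 1 (complexify (chart_map (affine_chart k) p)))
    (insert_entry k 0 (complexify u)) (insert_entry k 0 (complexify v)).

End ProjectiveSpace.

(* Main.v *)
(** In the affine chart, write the orthogonal coordinate map as a smooth map [w]
    from an open subset of R^4 to C^2, put W_i = d_i w, and let h = g + i Omega
    be the Fubini-Study Hermitian form, so that g is diagonal with entries G_i.
    The Christoffel symbols of a diagonal metric vanish on distinct indices, and
    so does R_ijkl; with the explicit curvature this yields
    Om_13 Om_24 = - Om_12 Om_34 and Om_14 Om_23 = Om_12 Om_34, and then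
    J^2 = - 1 forces 3 Om_ij^2 = G_i G_j for all i <> j.  Since Omega is
    parallel, differentiating this identity produces functions la_k such that
    d_i G_k = 2 G_k la_k Om_ik for i <> k.  The curvature components R_ijki give
    d_j d_k G_i in terms of G, Om and la; comparing these for different k, one
    finds la_i la_j = 0 for i <> j, differentiating once more all la_i vanish,
    and the remaining term Om_ij Om_ik of the curvature would be zero. *)
Require Import Defs.
From HB Require Import structures.
From mathcomp Require Import all_boot all_order all_algebra.
From mathcomp Require Import all_classical all_reals all_analysis.
From mathcomp Require Import complex ring lra.
Import Order.TTheory GRing.Theory Num.Theory numFieldNormedType.Exports.

Set Implicit Arguments.
Unset Strict Implicit.
Unset Printing Implicit Defensive.

Local Open Scope classical_set_scope.
Local Open Scope ring_scope.

(** * Functions smooth on an open set *)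

(** In [f + (g \- f)] the second summand vanishes near [x] and has differential 0. Differentiability
    in [is_Ck] is not relative to [U]; this locality makes it depend only on the values on an open
    [U]. *)
Lemma near_eq_differentiable (R : realType) (V W : normedModType R) (f g : V -> W) (x : V) :
  {near x, f =1 g} -> differentiable f x -> differentiable g x.
Proof.
move=> fg df; have -> : g = f + (g \- f).
  by rewrite funeqE => y /=; rewrite /GRing.add /= addrC subrK.
apply: differentiableD => //.
have e0 : (g \- f) x = 0 by rewrite /= (nbhs_singleton fg) subrr.
pose z : {linear V -> W} := \0.
have E : (g \- f) \o shift x = cst ((g \- f) x) + z +o_ 0 id.
  apply/eqaddoP => _/posnumP[e]; rewrite e0.
  have : \forall h \near 0, f (h + x) = g (h + x).
    have := fg; rewrite [X in X -> _](near_shift 0 x) subr0 => fg'.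
    by apply: filterS fg' => h /=.
  apply: filterS => h fgh.
  by rewrite /= /GRing.add /GRing.opp /= fgh subrr /cst /= addr0 subrr normr0 mulr_ge0.
apply/diff_locallyP.
have c0 : continuous z by move=> y; exact: cst_continuous.
have -> : 'd (g \- f) x = z :> (V -> W) by exact: diff_unique.
by [].
Qed.

Section Smooth.
Context {R : realType} {V : normedModType R} (U : set V) (oU : open U).
Implicit Types (W : normedModType R).

Lemma near_on (P : V -> Prop) x : (forall y, U y -> P y) -> U x -> \near x, P x.
Proof. by move=> UP Ux; apply: filterS UP _; exact: open_nbhs_nbhs. Qed.

Lemma eq_on_derive W (f g : V -> W) (v x : V) :
  (forall y, U y -> f y = g y) -> U x -> 'D_v f x = 'D_v g x.
Proof. by move=> fg Ux; apply: near_eq_derive; exact: near_on. Qed.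

Lemma eq_on_is_Ck W k (f g : V -> W) :
  (forall y, U y -> f y = g y) -> is_Ck k U f -> is_Ck k U g.
Proof.
elim: k f g => [|k IH] f g fg /=.
  move=> cf x Ux; have nfg := near_on fg Ux.
  have := cf x Ux; rewrite /prop_for /continuous_at (nbhs_singleton nfg).
  by apply: cvg_trans; apply: near_eq_cvg.
move=> [df Df]; split.
  by move=> x Ux; apply: near_eq_differentiable (df _ Ux); exact: near_on.
move=> v; apply: IH (Df v) => y Uy; exact: eq_on_derive.
Qed.

Lemma is_CkW W k (f : V -> W) : is_Ck k.+1 U f -> is_Ck k U f.
Proof.
elim: k f => [|k IH] f [df Df].
  by move=> x Ux; apply: differentiable_continuous; exact: df.
by split=> // v; apply: IH; exact: Df.
Qed.

Lemma smooth_derivable W (f : V -> W) v x :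
  smooth_on U f -> U x -> derivable f x v.
Proof. by move=> /(_ 1%N)[df _] Ux; apply: diff_derivable; exact: df. Qed.

Lemma smooth_onD_v W (f : V -> W) v : smooth_on U f -> smooth_on U ('D_v f).
Proof. by move=> sf k; have [_] := sf k.+1; exact. Qed.

Lemma is_Ck_cst W k (a : W) : is_Ck k U (cst a).
Proof.
elim: k a => [|k IH] a /=; first by move=> x _; exact: cst_continuous.
split=> [x _|v]; first exact: differentiable_cst.
by apply: eq_on_is_Ck (IH 0) => y _; rewrite derive_cst.
Qed.

Lemma is_CkD W k (f g : V -> W) : is_Ck k U f -> is_Ck k U g -> is_Ck k U (f \+ g).
Proof.
elim: k f g => [|k IH] f g /=.
  by move=> cf cg x Ux; apply: continuousD; [exact: cf|exact: cg].
move=> [df Df] [dg Dg]; split=> [x Ux|v].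
  by apply: differentiableD; [exact: df|exact: dg].
apply: eq_on_is_Ck (IH _ _ (Df v) (Dg v)) => y Uy /=.
by rewrite deriveD //; apply: diff_derivable; [exact: df|exact: dg].
Qed.

Lemma is_CkN W k (f : V -> W) : is_Ck k U f -> is_Ck k U (\- f).
Proof.
elim: k f => [|k IH] f /=.
  by move=> cf x Ux; apply: continuousN; exact: cf.
move=> [df Df]; split=> [x Ux|v]; first by apply: differentiableN; exact: df.
apply: eq_on_is_Ck (IH _ (Df v)) => y Uy /=.
by rewrite deriveN //; apply: diff_derivable; exact: df.
Qed.

Lemma is_CkM k (f g : V -> R) : is_Ck k U f -> is_Ck k U g -> is_Ck k U (f \* g).
Proof.
elim: k f g => [|k IH] f g.
  by move=> cf cg x Ux; apply: continuousM; [exact: cf|exact: cg].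
move=> Cf Cg; have [df Df] := Cf; have [dg Dg] := Cg; split=> [x Ux|v].
  by apply: differentiableM; [exact: df|exact: dg].
apply: (@eq_on_is_Ck _ _ ((f \* 'D_v g) \+ (g \* 'D_v f))) => [y Uy /=|].
  by rewrite deriveM //; apply: diff_derivable; [exact: df|exact: dg].
by apply: is_CkD; apply: IH; do ?[exact: is_CkW|exact: Df|exact: Dg].
Qed.

Lemma is_CkV k (f : V -> R) : (forall x, U x -> f x != 0) ->
  is_Ck k U f -> is_Ck k U (fun x => (f x)^-1).
Proof.
move=> f0; elim: k f f0 => [|k IH] f f0.
  by move=> cf x Ux; apply: (cvgV (f0 x Ux)); exact: cf.
move=> Cf; have [df Df] := Cf; split=> [x Ux|v].
  by apply: differentiableV; [exact: df|exact: f0].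
pose h x := (f x)^-1.
apply: (@eq_on_is_Ck _ _ (\- ((h \* h) \* 'D_v f))) => [y Uy /=|].
  rewrite deriveV ?f0 //; last by apply: diff_derivable; exact: df.
  by rewrite /h expr2 invfM scaleNr.
have hk : is_Ck k U h by apply: IH => //; exact: is_CkW.
by apply: is_CkN; apply: is_CkM; [exact: is_CkM|exact: Df].
Qed.

Lemma smooth_on_cst W (a : W) : smooth_on U (cst a).
Proof. by move=> k; exact: is_Ck_cst. Qed.
Lemma smooth_onD W (f g : V -> W) : smooth_on U f -> smooth_on U g -> smooth_on U (f \+ g).
Proof. by move=> sf sg k; exact: is_CkD. Qed.
Lemma smooth_onN W (f : V -> W) : smooth_on U f -> smooth_on U (\- f).
Proof. by move=> sf k; exact: is_CkN. Qed.
Lemma smooth_onM (f g : V -> R) : smooth_on U f -> smooth_on U g -> smooth_on U (f \* g).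
Proof. by move=> sf sg k; exact: is_CkM. Qed.
Lemma smooth_onV (f : V -> R) : (forall x, U x -> f x != 0) ->
  smooth_on U f -> smooth_on U (fun x => (f x)^-1).
Proof. by move=> f0 sf k; exact: is_CkV. Qed.
Lemma eq_smooth_on W (f g : V -> W) : (forall y, U y -> f y = g y) ->
  smooth_on U f -> smooth_on U g.
Proof. by move=> fg sf k; exact: eq_on_is_Ck fg (sf k). Qed.

Lemma smooth_deriveM (f g : V -> R) v x : smooth_on U f -> smooth_on U g -> U x ->
  'D_v (fun y => f y * g y) x = 'D_v f x * g x + f x * 'D_v g x.
Proof.
move=> sf sg Ux; transitivity (f x * 'D_v g x + g x * 'D_v f x); last first.
  by rewrite addrC [g x * _]mulrC.
exact: (deriveM (@smooth_derivable _ _ v _ sf Ux) (@smooth_derivable _ _ v _ sg Ux)).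
Qed.

Lemma smooth_deriveZ (c : R) (f : V -> R) v x : smooth_on U f -> U x ->
  'D_v (fun y => c * f y) x = c * 'D_v f x.
Proof.
move=> sf Ux; rewrite (smooth_deriveM v (smooth_on_cst c) sf Ux).
by rewrite derive_cst mul0r add0r.
Qed.

Lemma smooth_on_coord m (F : V -> 'rV[R]_m) j :
  smooth_on U F -> smooth_on U (fun x => F x 0 j).
Proof.
move=> sF k; have := sF k; elim: k F {sF} => [|k IH] F /=.
  move=> cF x Ux; apply: (@continuous_comp _ _ _ F (fun M : 'rV[R]_m => M 0 j)); first exact: cF.
  exact: coord_continuous.
move=> [dF DF]; split=> [x Ux|v].
  apply: (@differentiable_comp _ _ _ _ F (fun M : 'rV[R]_m => M 0 j)); first exact: dF.
  exact: differentiable_coord.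
apply: eq_on_is_Ck (IH _ (DF v)) => y Uy.
by rewrite derive_mx ?mxE //; apply: diff_derivable; exact: dF.
Qed.

End Smooth.

(** * Symmetry of second derivatives *)

Section Schwarz.
Context {R : realType} {V : normedModType R} (U : set V) (oU : open U).

Lemma is_derive_line (f : V -> R) (b u : V) (s : R) :
  derivable f (b + s *: u) u ->
  is_derive s 1 (fun t => f (b + t *: u)) ('D_u f (b + s *: u)).
Proof.
move=> df.
have E : (fun h => h^-1 *: (((fun t => f (b + t *: u)) \o shift s) (h *: 1) - f (b + s *: u))) =
   (fun h => h^-1 *: ((f \o shift (b + s *: u)) (h *: u) - f (b + s *: u))).
  rewrite funeqE => h /=; congr (_ *: (f _ - _)).
  by rewrite scalerDl addrCA -[h *: 1]/(h * 1) mulr1.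
by split; [rewrite /derivable E|rewrite /derive E].
Qed.

Lemma mean_value_line (f : V -> R) (b u : V) (t : R) : 0 < t ->
  (forall s, 0 <= s <= t -> derivable f (b + s *: u) u) ->
  exists2 s, 0 < s < t & f (b + t *: u) - f b = t * 'D_u f (b + s *: u).
Proof.
move=> t0 df; have dg s : 0 <= s <= t ->
    is_derive s 1 (fun t => f (b + t *: u)) ('D_u f (b + s *: u)).
  by move=> /df; exact: is_derive_line.
have [||s st E] := @MVT R (fun t => f (b + t *: u)) (fun s => 'D_u f (b + s *: u)) 0 t t0.
- by move=> s; rewrite in_itv /= => /andP[? ?]; apply: dg; rewrite !ltW.
- apply: derivable_within_continuous => s; rewrite in_itv /= => /dg[].
  by [].
- by exists s; move: st; rewrite ?in_itv //= => st; move: E; rewrite scale0r addr0 subr0 mulrC.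
Qed.

(** Two uses of the mean value theorem: along [u] for the difference f (x + t v) - f x, then along
    [v] for ['D_u f]. *)
Lemma second_difference (f : V -> R) (a u v : V) (t : R) : 0 < t ->
  (forall r s, 0 <= r <= t -> 0 <= s <= t -> U (a + r *: u + s *: v)) ->
  smooth_on U f ->
  exists r s, [/\ 0 < r < t, 0 < s < t &
    f (a + t *: u + t *: v) - f (a + t *: u) - (f (a + t *: v) - f a)
    = t * (t * 'D_v ('D_u f) (a + r *: u + s *: v))].
Proof.
move=> t0 HU sf; have tt : 0 <= t <= t by rewrite ltW //=.
have zt : (0 : R) <= 0 <= t by rewrite lexx ltW.
pose g x := f (x + t *: v) - f x.
have dg s : 0 <= s <= t -> is_derive s 1 (fun s => g (a + s *: u))
    ('D_u f (a + s *: u + t *: v) - 'D_u f (a + s *: u)).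
  move=> st; apply: is_deriveB.
    have -> : (fun s => f (a + s *: u + t *: v)) = (fun s => f (a + t *: v + s *: u)).
      by rewrite funeqE => ?; rewrite addrAC.
    rewrite addrAC; apply: is_derive_line; apply: smooth_derivable sf _.
    by rewrite addrAC; exact: HU.
  apply: is_derive_line; apply: smooth_derivable sf _.
  by have := HU s 0 st zt; rewrite scale0r addr0.
have wk s : s \in `]0, t[ -> 0 <= s <= t by rewrite in_itv /= => /andP[? ?]; rewrite !ltW.
have [|r rt E] := @MVT R (fun s => g (a + s *: u)) _ 0 t t0 (fun s st => dg s (wk s st)).
- apply: derivable_within_continuous => s; rewrite in_itv /= => /dg[].
  by [].
move: rt; rewrite in_itv /= => rt; have rt' : 0 <= r <= t by case/andP: rt => ? ?; rewrite !ltW.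
have [|s st Es] := @mean_value_line ('D_u f) (a + r *: u) v t t0.
  move=> s st; apply: (@smooth_derivable _ _ U); first exact: smooth_onD_v.
  exact: HU.
exists r, s; split=> //.
by rewrite -Es mulrC; move: E; rewrite /g scale0r addr0 subr0.
Qed.

(** The second difference is symmetric in [u] and [v], so in any small parallelogram at [a] a value
    of one mixed derivative equals a value of the other; continuity of both at [a] concludes. *)
Lemma schwarz (f : V -> R) (u v a : V) : smooth_on U f -> U a ->
  'D_u ('D_v f) a = 'D_v ('D_u f) a.
Proof.
move=> sf Ua.
have suv : smooth_on U ('D_u ('D_v f)) by do 2!apply: smooth_onD_v.
have svu : smooth_on U ('D_v ('D_u f)) by do 2!apply: smooth_onD_v.
apply/eqP; rewrite -subr_eq0 -normr_le0; apply/ler_addgt0Pl => e e0; rewrite addr0.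
have e2 : 0 < e / 2 by rewrite divr_gt0.
have cuv : \forall x \near a, `|'D_u ('D_v f) a - 'D_u ('D_v f) x| < e / 2.
  by move: e2; apply: cvgr_dist_lt; exact: (suv 0%N a Ua).
have cvu : \forall x \near a, `|'D_v ('D_u f) a - 'D_v ('D_u f) x| < e / 2.
  by move: e2; apply: cvgr_dist_lt; exact: (svu 0%N a Ua).
have near_U : nbhs a U by exact: open_nbhs_nbhs.
pose P x := [/\ U x, `|'D_u ('D_v f) a - 'D_u ('D_v f) x| < e / 2
  & `|'D_v ('D_u f) a - 'D_v ('D_u f) x| < e / 2].
have [d /= d0 Hd] : exists2 d : R, 0 < d & forall x, `|a - x| < d -> P x.
  have /nbhs_ballP[d d0 Hd] : \forall x \near a, P x.
    by apply: filterS3 near_U cuv cvu => x.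
  by exists d => // x ax; apply: Hd; rewrite -ball_normE.
(* With this side every point of the parallelogram is within d / 2 of [a]; the added 1 keeps the
   denominator positive when [u] and [v] vanish. *)
pose t := d / (2 * (`|u| + `|v| + 1)).
have M0 : 0 < `|u| + `|v| + 1 by rewrite ltr_wpDl ?addr_ge0.
have t0 : 0 < t by rewrite divr_gt0 // mulr_gt0.
have small r s : 0 <= r <= t -> 0 <= s <= t -> `|a - (a + r *: u + s *: v)| < d.
  move=> /andP[r0 rt] /andP[s0 st].
  rewrite -addrA opprD addrA subrr add0r normrN.
  apply: (le_lt_trans (ler_normD _ _)); rewrite !normrZ !ger0_norm //.
  apply: (@le_lt_trans _ _ (t * (`|u| + `|v| + 1))).
    by rewrite -addrA mulrDr lerD ?ler_wpM2r // mulrDr ler_wpDr ?mulr1 ?ler_wpM2r // ltW.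
  by rewrite /t invfM mulrA divfK ?gt_eqF // ltr_pdivrMr // ltr_pMr // ltr1n.
have weak (r : R) : 0 < r < t -> 0 <= r <= t by case/andP=> ? ?; rewrite !ltW.
have PU x : P x -> U x by case.
have [r [s [rt st E1]]] :=
  second_difference t0 (fun r s rt st => PU _ (Hd _ (small r s rt st))) sf.
have small' r' s' : 0 <= r' <= t -> 0 <= s' <= t -> `|a - (a + r' *: v + s' *: u)| < d.
  by rewrite addrAC => *; exact: small.
have [r' [s' [rt' st' E2]]] :=
  second_difference t0 (fun r s rt st => PU _ (Hd _ (small' r s rt st))) sf.
have E : 'D_v ('D_u f) (a + r *: u + s *: v) = 'D_u ('D_v f) (a + r' *: v + s' *: u).
  apply: (mulfI (lt0r_neq0 t0)); apply: (mulfI (lt0r_neq0 t0)).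
  apply: etrans (esym E1) _; apply: etrans _ E2.
  by rewrite [X in _ = f X - _ - _]addrAC; ring.
have [_ _ H1] := Hd _ (small _ _ (weak _ rt) (weak _ st)).
have [_ H2 _] := Hd _ (small' _ _ (weak _ rt') (weak _ st')).
rewrite E in H1; rewrite (splitr e); apply: le_trans (ler_distD _ _ _) (lerD (ltW H2) _).
by rewrite distrC; exact: ltW H1.
Qed.

End Schwarz.

(** * The Fubini-Study connection along a map to C^2 *)

Section Connection.
Context {A : comNzRingType} {I : Type} (cj : {rmorphism A -> A}) (d : I -> A -> A).
Context (dD : forall i x y, d i (x + y) = d i x + d i y)
  (dM : forall i x y, d i (x * y) = d i x * y + x * d i y)
  (dC : forall i j x, d i (d j x) = d j (d i x))
  (d_cj : forall i x, d i (cj x) = cj (d i x))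
  (cjK : involutive cj).
(* [A] stands for the ring of complex functions of the coordinates, [d i] for the
   coordinate derivatives, [w] for the affine coordinates of the point of CP^2, and
   [t] for 1 / (1 + |w|^2). *)
Context (w : A * A) (t : A).
Let W i : A * A := (d i w.1, d i w.2).
Context (cj_t : cj t = t)
  (t_inv : t * (1 + w.1 * cj w.1 + w.2 * cj w.2) = 1).

Definition fs_beta (x : A * A) : A := t * (x.1 * cj w.1 + x.2 * cj w.2).
Definition fs_herm (x y : A * A) : A :=
  t * (x.1 * cj y.1 + x.2 * cj y.2)
  - t ^+ 2 * (x.1 * cj w.1 + x.2 * cj w.2) * (w.1 * cj y.1 + w.2 * cj y.2).
(* In affine coordinates the Levi-Civita connection of the Fubini-Study metric is
   nabla_X Y = D_X Y - beta(X) Y - beta(Y) X; here it acts on vector fields along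
   [w]. *)
Definition fs_nabla (k : I) (x : A * A) : A * A :=
  (d k x.1 - fs_beta (W k) * x.1 - fs_beta x * (W k).1,
   d k x.2 - fs_beta (W k) * x.2 - fs_beta x * (W k).2).

Let d0 i : d i 0 = 0.
Proof. by apply: (addrI (d i 0)); rewrite -dD !addr0. Qed.
Let dN i x : d i (- x) = - d i x.
Proof. by apply: (addrI (d i x)); rewrite -dD !subrr d0. Qed.
Let dX2 i x : d i (x ^+ 2) = d i x * x + x * d i x.
Proof. by rewrite expr2 dM. Qed.

Let d_t i : d i t = - t ^+ 2 * (d i w.1 * cj w.1 + w.1 * cj (d i w.1)
                                + (d i w.2 * cj w.2 + w.2 * cj (d i w.2))).
Proof.
have d1 : d i 1 = 0.
  by apply: (addrI (d i 1)); rewrite addr0 -[in RHS](mulr1 1) dM mulr1 mul1r.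
have := congr1 (d i) t_inv; rewrite !(dM, dD) d1 add0r !d_cj => /eqP.
rewrite addr_eq0 => /eqP E; rewrite -[LHS]mulr1 -[X in _ * X = _]t_inv mulrCA E.
by ring.
Qed.

Let dE := (dD, dN, dX2, dM, d_cj, d_t).

(** The connection preserves the Hermitian form: the real part gives metric compatibility, the
    imaginary part says that the Kaehler form is parallel. *)
Lemma d_fs_herm k x y :
  d k (fs_herm x y) = fs_herm (fs_nabla k x) y + fs_herm x (fs_nabla k y).
Proof.
rewrite /fs_herm /fs_nabla /fs_beta /W /= !dE !rmorphB !rmorphM !rmorphD !rmorphM !cjK cj_t.
by ring.
Qed.

(** Curvature of constant holomorphic sectional curvature 4, in complex form; [a] is 2 i Im h(W_i,
    W_k) for the Hermitian form h. There is no bracket term because the [d i] commute. *)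
Lemma fs_nabla_comm k i x :
  let kx := fs_nabla k (fs_nabla i x) in let ix := fs_nabla i (fs_nabla k x) in
  let a := fs_herm (W i) (W k) - fs_herm (W k) (W i) in
  let b := fs_herm x (W k) in let c := fs_herm x (W i) in
  kx.1 - ix.1 = - a * x.1 - b * d i w.1 + c * d k w.1 /\
  kx.2 - ix.2 = - a * x.2 - b * d i w.2 + c * d k w.2.
Proof.
rewrite /fs_herm /fs_nabla /fs_beta /W /= !dE !(dC k i).
split; by ring.
Qed.

(** The connection has no torsion: its correction terms are symmetric and the [d i] commute. *)
Lemma fs_nablaC i j : fs_nabla i (W j) = fs_nabla j (W i).
Proof. by rewrite /fs_nabla /W /= !(dC i j); congr pair; ring. Qed.

Lemma cj_fs_herm x y : cj (fs_herm x y) = fs_herm y x.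
Proof.
rewrite /fs_herm !rmorphB !rmorphM !rmorphD !rmorphM /= ?rmorphXn ?rmorphM !cjK cj_t.
by ring.
Qed.

(** By [d_fs_herm] each derivative is a second covariant derivative paired with [W l], plus a
    pairing of first ones; the second ones differ by the commutator of [fs_nabla_comm]. *)
Lemma d_fs_christoffel i j k l :
  let h i j := fs_herm (W i) (W j) in
  let T i j := fs_nabla i (W j) in
  d k (fs_herm (T i j) (W l)) - d i (fs_herm (T k j) (W l)) =
    - (h i k - h k i) * h j l - h j k * h i l + h j i * h k l
    + fs_herm (T i j) (T k l) - fs_herm (T k j) (T i l).
Proof.
move=> h T; rewrite !d_fs_herm -/(T k l) -/(T i l).
have [E1 E2] := fs_nabla_comm k i (W j).
rewrite /T; set X := fs_nabla k _; set Y := fs_nabla i (fs_nabla k _).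
have -> : fs_herm X (W l) + fs_herm (fs_nabla i (W j)) (T k l) -
  (fs_herm Y (W l) + fs_herm (fs_nabla k (W j)) (T i l)) =
  fs_herm (X.1 - Y.1, X.2 - Y.2) (W l) +
  fs_herm (fs_nabla i (W j)) (T k l) - fs_herm (fs_nabla k (W j)) (T i l).
  by rewrite {1 3 5}/fs_herm /=; ring.
rewrite E1 E2 -/(h i k) -/(h k i) -/(h j k) -/(h j i).
congr (_ + _ - _).
move: (h i k) (h k i) (h j k) (h j i) => a b c e.
by rewrite /h /fs_herm /W /=; ring.
Qed.

End Connection.

(** * Orthogonal frames with the curvature of CP^2 *)

(** Allows sums over the frame to be expanded along arbitrary distinct indices, without numbering
    them. *)
Lemma sum_uniq4 (M : nmodType) (F : 'I_4 -> M) (i j k l : 'I_4) :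
  uniq [:: i; j; k; l] -> \sum_m F m = F i + F j + F k + F l.
Proof.
move=> u; rewrite (perm_big [:: i; j; k; l]).
  by rewrite !big_cons big_nil /= addr0 !addrA.
apply: uniq_perm; rewrite ?index_enum_uniq // => m; rewrite mem_index_enum.
have [||_ ->] := @uniq_min_size _ [:: i; j; k; l] (enum 'I_4) u _; last by rewrite mem_enum.
  by move=> p _; rewrite mem_enum.
by rewrite size_enum_ord.
Qed.

Section Pointwise.
Context {R : realFieldType}.
Implicit Types a b c e : R.

Lemma third_of_sums (q12 q13 q14 q23 q24 q34 : R) :
  0 <= q12 -> 0 <= q13 -> 0 <= q14 ->
  q12 + q13 + q14 = 1 -> q12 + q23 + q24 = 1 ->
  q13 + q23 + q34 = 1 -> q14 + q24 + q34 = 1 ->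
  q12 * q34 = q13 * q24 -> q12 * q34 = q14 * q23 -> q12 = 1 / 3.
Proof.
move=> h12 h13 h14 e1 e2 e3 e4.
have -> : q34 = q12 by lra.
have -> : q24 = q13 by lra.
have -> : q23 = q14 by lra.
rewrite -!expr2 => /eqP; rewrite eqrXn2 // => /eqP E1 /eqP; rewrite eqrXn2 // => /eqP E2.
by lra.
Qed.

(* The [q] of the previous lemma are the squares of the normalized components
   o_ij^2 / (G_i G_j); opposite ones are equal, and the relations between their
   products make all of them equal. *)
Lemma kahler_angle (a b c e o12 o13 o14 o23 o24 o34 : R) :
  0 < a -> 0 < b -> 0 < c -> 0 < e ->
  o12 ^+ 2 / b + o13 ^+ 2 / c + o14 ^+ 2 / e = a ->
  o12 ^+ 2 / a + o23 ^+ 2 / c + o24 ^+ 2 / e = b ->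
  o13 ^+ 2 / a + o23 ^+ 2 / b + o34 ^+ 2 / e = c ->
  o14 ^+ 2 / a + o24 ^+ 2 / b + o34 ^+ 2 / c = e ->
  o13 * o24 = - (o12 * o34) -> o14 * o23 = o12 * o34 ->
  3 * o12 ^+ 2 = a * b.
Proof.
move=> a0 b0 c0 e0 E1 E2 E3 E4 E5 E6.
have [an bn cn en] : [/\ a != 0, b != 0, c != 0 & e != 0] by split; exact: lt0r_neq0.
have -> : o12 ^+ 2 = (o12 ^+ 2 / (a * b)) * (a * b) by field; rewrite an bn.
have E5' : (o13 * o24) ^+ 2 = (o12 * o34) ^+ 2 by rewrite E5 sqrrN.
have E6' : (o14 * o23) ^+ 2 = (o12 * o34) ^+ 2 by rewrite E6.
rewrite (@third_of_sums (o12 ^+ 2 / (a * b)) (o13 ^+ 2 / (a * c)) (o14 ^+ 2 / (a * e))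
  (o23 ^+ 2 / (b * c)) (o24 ^+ 2 / (b * e)) (o34 ^+ 2 / (c * e))).
- by field.
- by rewrite divr_ge0 ?sqr_ge0 // mulr_ge0 // ltW.
- by rewrite divr_ge0 ?sqr_ge0 // mulr_ge0 // ltW.
- by rewrite divr_ge0 ?sqr_ge0 // mulr_ge0 // ltW.
- by apply: (mulfI an); rewrite mulr1 -[RHS]E1; field; rewrite an bn cn en.
- by apply: (mulfI bn); rewrite mulr1 -[RHS]E2; field; rewrite an bn cn en.
- by apply: (mulfI cn); rewrite mulr1 -[RHS]E3; field; rewrite an bn cn en.
- by apply: (mulfI en); rewrite mulr1 -[RHS]E4; field; rewrite an bn cn en.
- transitivity ((o12 * o34) ^+ 2 / (a * b * c * e)); first by field; rewrite an bn cn en.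
  by rewrite -E5'; field; rewrite an bn cn en.
- transitivity ((o12 * o34) ^+ 2 / (a * b * c * e)); first by field; rewrite an bn cn en.
  by rewrite -E6'; field; rewrite an bn cn en.
Qed.

End Pointwise.

(** * Choosing distinct indices among four *)

Lemma exists_notin4 (s : seq 'I_4) : (size s < 4)%N -> exists k, k \notin s.
Proof.
move=> s4; apply: contrapT => /forallNP H; suff : (4 <= size s)%N by rewrite leqNgt s4.
rewrite -[X in (X <= _)%N](size_enum_ord 4) uniq_leq_size ?enum_uniq // => k _.
by apply: contrapT => /negP; exact: H.
Qed.

Lemma uniq4_exists (i j : 'I_4) : i != j -> exists k l, uniq [:: i; j; k; l].
Proof.
move=> ij; have [k kN] := @exists_notin4 [:: j; i] isT.
have [l lN] := @exists_notin4 [:: k; j; i] isT.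
by exists k, l; rewrite -rev_uniq /rev /= lN kN inE eq_sym ij.
Qed.

Lemma uniq3_exists (i j k : 'I_4) : i != j -> j != k -> i != k ->
  exists l, uniq [:: i; j; k; l].
Proof.
move=> ij jk ik; have [l] := @exists_notin4 [:: i; j; k] isT.
rewrite !inE !negb_or ![l == _]eq_sym => /and3P[il jl kl].
by exists l; rewrite /= !inE !negb_or ij ik il jk jl kl.
Qed.

Lemma uniq4P (i j k l : 'I_4) : uniq [:: i; j; k; l] ->
  [/\ [/\ i != j, i != k & i != l], [/\ j != k, j != l & k != l],
   [/\ j != i, k != i & l != i] & [/\ k != j, l != j & l != k]].
Proof.
rewrite /= !inE !negb_or !andbT => /and3P[/and3P[ij ik il] /andP[jk jl] kl].
by split; split=> //; rewrite eq_sym.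
Qed.

(** * Differential equations of an orthogonal frame *)

Section OrthogonalFrame.
Context {R : realType} {V : normedModType R} (U : set V) (oU : open U).
Context (e : 'I_4 -> V).
Let d k (f : V -> R) : V -> R := 'D_(e k) f.
Context (G : 'I_4 -> V -> R) (Om : 'I_4 -> 'I_4 -> V -> R)
  (Gam : 'I_4 -> 'I_4 -> 'I_4 -> V -> R).
(* [G], [Om] and [Gam] are the components g(d_i, d_i), Omega(d_i, d_j) and
   g(nabla_i d_j, d_k) in orthogonal coordinates; the Parseval identity of the
   orthogonal frame turns products of vectors into sums weighted by 1 / G_m. *)
Let g i j x := if i == j then G i x else 0.
Context (sG : forall i, smooth_on U (G i)) (sOm : forall i j, smooth_on U (Om i j)).
Context (G0 : forall i x, U x -> 0 < G i x)
  (OmN : forall i j x, U x -> Om j i x = - Om i j x)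
  (GamC : forall i j k x, U x -> Gam i j k x = Gam j i k x)
  (koszul : forall i j k x, U x ->
     Gam k i j x + Gam k j i x = if i == j then d k (G i) x else 0)
  (JJ : forall i j x, U x ->
     \sum_m Om m i x * Om m j x / G m x = g i j x)
  (parallel : forall i j k x, U x ->
     d k (Om i j) x =
     \sum_m (Gam k i m x * Om m j x - Gam k j m x * Om m i x) / G m x)
  (curvature : forall i j k l x, U x ->
     d k (Gam i j l) x - d i (Gam k j l) x
     - \sum_m (Gam i j m x * Gam k l m x - Gam k j m x * Gam i l m x) / G m x
     = 2 * Om i k x * Om j l x - g j k x * g i l x + Om j k x * Om i l x
       + g j i x * g k l x - Om j i x * Om k l x).

(** Koszul's formula for a diagonal metric; in particular [Gam] vanishes on three distinct
    indices. *)
Lemma GamE i j k x : U x -> Gam i j k x =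
  ((if i == k then d j (G i) x else 0) + (if j == k then d i (G j) x else 0)
   - (if i == j then d k (G i) x else 0)) / 2.
Proof.
move=> Ux; have := koszul i j k Ux; have := koszul j k i Ux; have := koszul i k j Ux.
rewrite (GamC k i j Ux) (GamC k j i Ux) (GamC j i k Ux) => E1 E2 E3.
by lra.
Qed.

Lemma Om_ii i x : U x -> Om i i x = 0.
Proof. by move=> Ux; have := OmN i i Ux => E; lra. Qed.

(** The left side of [curvature] vanishes here: the differentiated symbols have distinct indices on
    all of [U], and every product in the sum has a factor with three distinct indices. *)
Lemma bianchi_distinct i j k l x : U x -> uniq [:: i; j; k; l] ->
  2 * Om i k x * Om j l x + Om j k x * Om i l x + Om i j x * Om k l x = 0.
Proof.
move=> Ux u; have [[/negPf ij /negPf ik /negPf il] [/negPf jk /negPf jl /negPf kl]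
  [/negPf ji /negPf ki /negPf li] [/negPf kj /negPf lj /negPf lk]] := uniq4P u.
have neq := (ij, ik, il, jk, jl, kl, ji, ki, li, (kj, lj, lk, @eqxx)).
have Z a b c : a == b = false -> b == c = false -> a == c = false ->
    forall p, d p (Gam a b c) x = 0.
  move=> ab bc ac p; rewrite /d (@eq_on_derive _ _ _ oU _ _ (cst 0) _ _ _ Ux).
    by rewrite derive_cst.
  move=> y Uy.
  by rewrite GamE // ab bc ac !addr0 subr0 mul0r.
have := curvature i j k l Ux; rewrite (sum_uniq4 _ u) !Z // /g !GamE // !neq (OmN i j) //.
by move=> /eqP; rewrite -subr_eq0 => /eqP E; rewrite -[RHS]oppr0 -E; ring.
Qed.

(** Exchanging [j] and [k] in [bianchi_distinct] gives a second linear equation for the three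
    products, so two of them are determined by the third. *)
Lemma Om_products i j k l x : U x -> uniq [:: i; j; k; l] ->
  Om i k x * Om j l x = - (Om i j x * Om k l x) /\
  Om i l x * Om j k x = Om i j x * Om k l x.
Proof.
move=> Ux u; have u' : uniq [:: i; k; j; l].
  have [[? ? ?] [? ? ?] _ [? _ _]] := uniq4P u; rewrite /= !inE !negb_or.
  by do !(apply/andP; split).
have := bianchi_distinct Ux u; have := bianchi_distinct Ux u'.
by rewrite (OmN j k) // => E E'; split; lra.
Qed.

Lemma Om_sqr i j x : U x -> i != j -> 3 * Om i j x ^+ 2 = G i x * G j x.
Proof.
move=> Ux ij; have [k [l u]] := uniq4_exists ij.
have [E1 E2] := Om_products Ux u.
have J m := JJ m m Ux.
have [Ji Jj Jk Jl] : [/\ _, _, _ & _] := And4 (J i) (J j) (J k) (J l).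
move: Ji Jj Jk Jl; rewrite !(sum_uniq4 _ u) /g !eqxx !Om_ii //.
rewrite (OmN i j) // (OmN i k) // (OmN i l) // (OmN j k) // (OmN j l) // (OmN k l) //.
rewrite !mulrNN !mul0r !addr0 !add0r -!expr2 => Ji Jj Jk Jl.
apply: (@kahler_angle _ _ _ (G k x) (G l x) _ (Om i k x) (Om i l x)
    (Om j k x) (Om j l x) (Om k l x));
  rewrite ?G0 //; lra.
Qed.

Lemma Om_neq0 i j x : U x -> i != j -> Om i j x != 0.
Proof.
move=> Ux ij; apply/eqP => O0; have := Om_sqr Ux ij; rewrite O0 expr0n /= mulr0 => /esym/eqP.
by rewrite mulf_eq0 !gt_eqF ?G0.
Qed.

Lemma d_Om i j k x : U x -> i != j ->
  2 * G i x * G j x * d k (Om i j) x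
  = (d k (G i) x * G j x + G i x * d k (G j) x) * Om i j x.
Proof.
move=> Ux ij.
have : d k (fun y => 3 * (Om i j y * Om i j y)) x = d k (fun y => G i y * G j y) x.
  by apply: (@eq_on_derive _ _ _ oU) => // y Uy; rewrite -expr2 Om_sqr.
rewrite /d (@smooth_deriveZ _ _ U) ?(smooth_deriveM _ _ _ Ux) //; last exact: smooth_onM.
move=> E.
have := Om_sqr Ux ij => E2.
have {}E := congr1 ( *%R (Om i j x)) E.
have {}E2 := congr1 ( *%R (2 * d k (Om i j) x)) E2.
rewrite /d in E E2 *; lra.
Qed.

(** Both [parallel] and [d_Om] compute d_k Om_ij; the terms in the derivatives of [G i] and [G j]
    agree, which leaves those of [G k]. *)
Lemma d_G_proportional i j k x : U x -> i != j -> j != k -> i != k ->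
  d i (G k) x * Om j k x = d j (G k) x * Om i k x.
Proof.
move=> Ux ij' jk' ik'.
have [l u] := uniq3_exists ij' jk' ik'.
have [[/negPf ij /negPf ik /negPf il] [/negPf jk /negPf jl /negPf kl]
  [/negPf ji /negPf ki /negPf li] [/negPf kj /negPf lj /negPf lk]] := uniq4P u.
have neq := (ij, ik, il, jk, jl, kl, ji, ki, li, (kj, lj, lk, @eqxx)).
have := parallel i j k Ux; rewrite (sum_uniq4 _ u) !GamE // !neq !Om_ii // (OmN i j) // => E1.
have := d_Om k Ux ij' => E2.
have Gi := lt0r_neq0 (G0 i Ux); have Gj := lt0r_neq0 (G0 j Ux); have Gk := lt0r_neq0 (G0 k Ux).
have Gl := lt0r_neq0 (G0 l Ux).
have : G i x * G j x / G k x * (d i (G k) x * Om k j x - d j (G k) x * Om k i x) = 0.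
  move/eqP: E2; rewrite -subr_eq0 => /eqP <-; rewrite E1.
  by rewrite !(if_same, addr0, add0r, subr0, sub0r, mul0r, mulr0); field; rewrite Gi Gj Gk Gl.
move/eqP; rewrite !mulf_eq0 invr_eq0 (negPf Gi) (negPf Gj) (negPf Gk) /= (OmN j k) // (OmN i k) //.
by move/eqP => E; lra.
Qed.

(** The quotient of d_i G_k by Om_ik does not depend on i, so a single [j] different from [k]
    computes it. The numbers [la] are chosen point by point and never differentiated. *)
Lemma d_G_lambda k x : U x -> exists la : R,
  forall i, i != k -> d i (G k) x = 2 * G k x * la * Om i k x.
Proof.
move=> Ux; have [j] := @exists_notin4 [:: k] isT; rewrite inE => jk.
have Gk := lt0r_neq0 (G0 k Ux); have O := Om_neq0 Ux jk.
exists (d j (G k) x / (2 * G k x * Om j k x)) => i ik.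
have [->|ij] := eqVneq i j; first by field; rewrite Gk O.
apply: (mulIf O); rewrite (d_G_proportional Ux ij jk ik).
by field; rewrite Gk O.
Qed.

Lemma d_G_lambdas x : U x -> exists la : 'I_4 -> R,
  forall k i, i != k -> d i (G k) x = 2 * G k x * la k * Om i k x.
Proof.
by move=> Ux; have /choice[la L] := fun k => d_G_lambda k Ux; exists la.
Qed.

(** The curvature component with indices j, k, i, i: [Gam j k i] vanishes on [U] and [Gam i k i] is
    half of d_k G_i. Without the term in [Om] these are the Lame equations of flat orthogonal
    coordinates. *)
Lemma lame i j k x : U x -> i != j -> j != k -> i != k ->
  d j (d k (G i)) x = 2 * (- 3 * Om i j x * Om i k x
    + d k (G j) x * d j (G i) x / (4 * G j x)
    + d j (G k) x * d k (G i) x / (4 * G k x)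
    + d k (G i) x * d j (G i) x / (4 * G i x)).
Proof.
move=> Ux ij' jk' ik'.
have [l u] := uniq3_exists ij' jk' ik'.
have [[/negPf ij /negPf ik /negPf il] [/negPf jk /negPf jl /negPf kl]
  [/negPf ji /negPf ki /negPf li] [/negPf kj /negPf lj /negPf lk]] := uniq4P u.
have neq := (ij, ik, il, jk, jl, kl, ji, ki, li, (kj, lj, lk, @eqxx)).
have Gi := lt0r_neq0 (G0 i Ux); have Gj := lt0r_neq0 (G0 j Ux); have Gk := lt0r_neq0 (G0 k Ux).
have Gl := lt0r_neq0 (G0 l Ux).
have Z : d i (Gam j k i) x = 0.
  rewrite /d (@eq_on_derive _ _ _ oU _ _ (cst 0) _ _ _ Ux) ?derive_cst // => y Uy.
  by rewrite GamE // !neq !addr0 subr0 mul0r.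
have D : d j (Gam i k i) x = 2^-1 * d j (d k (G i)) x.
  rewrite /d -(@smooth_deriveZ _ _ U) //; last exact: smooth_onD_v.
  by apply: (@eq_on_derive _ _ _ oU) => // y Uy; rewrite GamE // !neq addr0 subr0 mulrC.
have := curvature j k i i Ux; rewrite Z D /g (sum_uniq4 _ u) !GamE // !neq !Om_ii //.
rewrite (OmN i j) // (OmN i k) // => /(congr1 ( *%R (-2))).
move/eqP; rewrite -subr_eq0 => /eqP E; apply/eqP; rewrite -subr_eq0; apply/eqP; rewrite -[RHS]E.
by field; rewrite Gi Gj Gk Gl.
Qed.

Let dOm_lambda i j k x (la : 'I_4 -> R) : U x -> i != j -> j != k -> i != k ->
  (forall k i, i != k -> d i (G k) x = 2 * G k x * la k * Om i k x) ->
  d k (Om i j) x = (la i * Om k i x + la j * Om k j x) * Om i j x.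
Proof.
move=> Ux ij jk ik L; have := d_Om k Ux ij.
rewrite (L i k) 1?eq_sym // (L j k) 1?eq_sym // => E.
have Gi := lt0r_neq0 (G0 i Ux); have Gj := lt0r_neq0 (G0 j Ux).
have GG : 2 * G i x * G j x != 0 by rewrite !mulf_neq0 // pnatr_eq0.
by apply: (mulfI GG); rewrite E; ring.
Qed.

Let lame_lambda i j k x (la : 'I_4 -> R) : U x -> i != j -> j != k -> i != k ->
  (forall k i, i != k -> d i (G k) x = 2 * G k x * la k * Om i k x) ->
  d j (d k (G i)) x = 2 * (- 3 * Om i j x * Om i k x
    + G i x * la i * (la j * Om j k x * Om i j x - la k * Om j k x * Om i k x
                      + la i * Om i k x * Om i j x)).
Proof.
move=> Ux ij jk ik L; rewrite lame // !L // 1?eq_sym //.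
rewrite (OmN j k) // (OmN i j) // (OmN i k) //.
have Gi := lt0r_neq0 (G0 i Ux); have Gj := lt0r_neq0 (G0 j Ux); have Gk := lt0r_neq0 (G0 k Ux).
by field; rewrite Gi Gj Gk.
Qed.

Lemma lambda_mul0 i j x : U x -> i != j -> forall la : 'I_4 -> R,
  (forall k i, i != k -> d i (G k) x = 2 * G k x * la k * Om i k x) -> la i * la j = 0.
Proof.
move=> Ux ij la L; have [k [l u]] := uniq4_exists ij.
have [[_ ik il] [jk jl kl] [ji ki li] [kj lj lk]] := uniq4P u.
(* Derivative along [e j] of the relation d_k G_i Om_li = d_l G_i Om_ki. *)
have E : d j (d k (G i)) x * Om l i x + d k (G i) x * d j (Om l i) x =
         d j (d l (G i)) x * Om k i x + d l (G i) x * d j (Om k i) x.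
  have sdG a : smooth_on U ('D_(e a) (G i)) by exact: smooth_onD_v.
  rewrite /d -!(smooth_deriveM _ _ _ Ux) //.
  apply: (@eq_on_derive _ _ _ oU) => // y Uy; exact: d_G_proportional.
move: E; rewrite !(@dOm_lambda _ _ _ _ la) // !(@lame_lambda _ _ _ _ la) // !L //.
have [B C] := Om_products Ux u.
rewrite (OmN i k) // (OmN i l) // (OmN i j) // => E.
have Gi := G0 i Ux; have Oij := Om_neq0 Ux ij; have Okl := Om_neq0 Ux kl.
(* The terms of [E] without the factor la_i la_j cancel; by [Om_products] the coefficient that
   remains is nonzero. *)
have : G i x * Om i j x * (Om i j x * Om k l x) * (la i * la j) = 0.
  transitivity (G i x * Om i j x * (Om i l x * Om j k x - Om i k x * Om j l x) / 2 * (la i * la j)).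
    by rewrite B C; field.
  lra.
have nz : G i x * Om i j x * (Om i j x * Om k l x) != 0 by rewrite !mulf_neq0 // gt_eqF.
by move/eqP; rewrite mulf_eq0 (negPf nz) => /eqP.
Qed.

(** The product of d_l G_i and d_l G_j is a multiple of la_i la_j, hence zero on all of [U]; this is
    its derivative along [e k]. *)
Let d_pp_zero i j k l x : U x -> uniq [:: i; j; k; l] ->
  d k (d l (G i)) x * d l (G j) x + d l (G i) x * d k (d l (G j)) x = 0.
Proof.
move=> Ux u; have [[ij ik il] [jk jl kl] [ji ki li] [kj lj lk]] := uniq4P u.
have sdG a b : smooth_on U ('D_(e a) (G b)) by exact: smooth_onD_v.
rewrite /d -!(smooth_deriveM _ _ _ Ux) //.
rewrite (@eq_on_derive _ _ _ oU _ _ (cst 0)) ?derive_cst // => y Uy.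
have [la L] := d_G_lambdas Uy.
have -> : 'D_(e l) (G i) y * 'D_(e l) (G j) y =
    4 * G i y * G j y * Om l i y * Om l j y * (la i * la j).
  by transitivity (d l (G i) y * d l (G j) y); rewrite // !L //; ring.
by rewrite (lambda_mul0 Uy ij) ?mulr0.
Qed.

Let lambda_eq0 i x : U x -> forall la : 'I_4 -> R,
  (forall k i, i != k -> d i (G k) x = 2 * G k x * la k * Om i k x) -> la i = 0.
Proof.
move=> Ux la L; have [j ji] := @exists_notin4 [:: i] isT.
have ij : i != j by move: ji; rewrite inE eq_sym.
have [k [l u]] := uniq4_exists ij.
have [[_ ik il] [jk jl kl] [_ ki li] [kj lj lk]] := uniq4P u.
have lij := lambda_mul0 Ux ij L.
have [//|li0] := eqVneq (la i) 0.
have lj0 : la j = 0 by move/eqP: lij; rewrite mulf_eq0 (negPf li0) => /eqP.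
(* As la_j = 0, d_l G_j vanishes and d_k d_l G_j is - 6 Om_jk Om_jl, so the relation makes a product
   of nonzero factors vanish. *)
have := d_pp_zero Ux u; rewrite !(@lame_lambda _ _ _ _ la) // !L // lj0.
rewrite !(mulr0, mul0r, addr0, add0r).
move/eqP; rewrite !mulf_eq0 !oppr_eq0 !pnatr_eq0 /= (negPf li0) (gt_eqF (G0 i Ux)).
by rewrite !(negPf (Om_neq0 Ux _)).
Qed.

Lemma no_orthogonal_frame : U = set0.
Proof.
rewrite -subset0 => x Ux.
have [j] := @exists_notin4 [:: ord0] isT; rewrite inE eq_sym => ij.
have [k [l u]] := uniq4_exists ij.
have [[_ ik _] [jk _ _] [ji ki _] [kj _ _]] := uniq4P u.
have zero a b : a != b -> forall y, U y -> d b (G a) y = 0.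
  move=> ab y Uy; have [la L] := d_G_lambdas Uy.
  by rewrite L 1?eq_sym // (lambda_eq0 a Uy L) mulr0 mul0r.
have := @lame ord0 j k x Ux ij jk ik; rewrite !(zero ord0) // !(zero j) // !(zero k) //.
rewrite /d (@eq_on_derive _ _ _ oU _ _ (cst 0) _ _ _ Ux) ?derive_cst; last exact: zero.
move=> /esym/eqP; rewrite !mul0r !addr0 !mulf_eq0 oppr_eq0 !pnatr_eq0 /=.
by rewrite !(negPf (Om_neq0 Ux _)).
Qed.

End OrthogonalFrame.

(** * The differential ring of smooth complex functions *)

Section SmoothComplex.
Context {R : realType} {V : normedModType R} (U : set V) (oU : open U).

Definition csmooth_on (f : V -> R[i]) : Prop :=
  smooth_on U (fun x => complex.Re (f x)) /\ smooth_on U (fun x => complex.Im (f x)).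

Definition csmooth : {pred V -> R[i]} := fun f => `[< csmooth_on f >].

Lemma csmooth_cst c : csmooth_on (cst c).
Proof. by split; exact: smooth_on_cst. Qed.

Lemma csmoothB f g : csmooth_on f -> csmooth_on g -> csmooth_on (f \- g).
Proof.
move=> [fr fi] [gr gi]; split.
  apply: eq_smooth_on (smooth_onD oU fr (smooth_onN oU gr)) => // x _ /=.
  by case: (f x) (g x) => a b [a' b'].
apply: eq_smooth_on (smooth_onD oU fi (smooth_onN oU gi)) => // x _ /=.
by case: (f x) (g x) => a b [a' b'].
Qed.

Lemma csmoothM f g : csmooth_on f -> csmooth_on g -> csmooth_on (f \* g).
Proof.
move=> [fr fi] [gr gi]; split.
  have := smooth_onD oU (smooth_onM oU fr gr) (smooth_onN oU (smooth_onM oU fi gi)).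
  apply: eq_smooth_on => // x _ /=.
  by case: (f x) (g x) => a b [a' b'].
apply: eq_smooth_on (smooth_onD oU (smooth_onM oU fr gi) (smooth_onM oU fi gr)) => // x _ /=.
by case: (f x) (g x) => a b [a' b'].
Qed.

Lemma csmooth_subring : subring_closed csmooth.
Proof.
split; first by apply/asboolP; exact: (csmooth_cst 1).
  by move=> f g /asboolP sf /asboolP sg; apply/asboolP; exact: csmoothB.
by move=> f g /asboolP sf /asboolP sg; apply/asboolP; exact: csmoothM.
Qed.

(** The functions are total and compared everywhere; only smoothness is restricted to [U]. The proof
    that [U] is open indexes the type because the ring structure is built from it. *)
Record cfun (o : open U) := CFun { cfun_val :> V -> R[i]; cfunP : cfun_val \in csmooth }.
Local Notation A := (cfun oU).
HB.instance Definition _ := [isSub for @cfun_val oU].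
HB.instance Definition _ := [Choice of A by <:].
HB.instance Definition _ :=
  GRing.SubChoice_isSubComNzRing.Build _ csmooth A csmooth_subring.

Implicit Types f g : A.

Lemma cfun_eq f g : f =1 g -> f = g.
Proof. by move=> fg; apply/val_inj; exact/funext. Qed.

Lemma cfun_smooth f : csmooth_on f.
Proof. exact/asboolP/cfunP. Qed.

Definition mk_cfun (f : V -> R[i]) (sf : csmooth_on f) : A :=
  @CFun oU f (introT (asboolP _) sf).

(* Being extended by 0 outside [U], these derivations satisfy the Leibniz rule and
   commute as operators on functions, not only on [U]. *)
Definition cderive_fun (v : V) (f : V -> R[i]) (x : V) : R[i] :=
  if `[< U x >] then
    ('D_v (fun y => complex.Re (f y)) x +i* 'D_v (fun y => complex.Im (f y)) x)%C
  else 0.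

Lemma cderive_smooth v f : csmooth_on (cderive_fun v f).
Proof.
have [fr fi] := cfun_smooth f.
split.
  apply: (eq_smooth_on oU _ (smooth_onD_v v fr)) => x Ux.
  by rewrite /cderive_fun asboolT.
apply: (eq_smooth_on oU _ (smooth_onD_v v fi)) => x Ux.
by rewrite /cderive_fun asboolT.
Qed.

Definition cderive v f : A := mk_cfun (cderive_smooth v f).

Lemma conjc_smooth f : csmooth_on (fun x => (f x)^*%C).
Proof.
have [fr fi] := cfun_smooth f; split.
  by apply: (eq_smooth_on oU _ fr) => x _; case: (f x).
by apply: (eq_smooth_on oU _ (smooth_onN oU fi)) => x _ /=; case: (f x).
Qed.

Definition cconj f : A := mk_cfun (conjc_smooth f).

Lemma cconj_zmod : zmod_morphism cconj.
Proof. move=> f g; apply: cfun_eq => x.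
transitivity ((f x - g x)^*%C); first by [].
transitivity ((f x)^*%C - (g x)^*%C); last by [].
exact: rmorphB. Qed.
Lemma cconj_monoid : monoid_morphism cconj.
Proof.
split=> [|f g]; apply: cfun_eq => x; first exact: (rmorph1 (@conjc R)).
transitivity ((f x * g x)^*%C); first by [].
transitivity ((f x)^*%C * (g x)^*%C); last by [].
exact: rmorphM.
Qed.
HB.instance Definition _ := GRing.isZmodMorphism.Build A A cconj cconj_zmod.
HB.instance Definition _ := GRing.isMonoidMorphism.Build A A cconj cconj_monoid.

Lemma cconjK : involutive cconj.
Proof. by move=> f; apply: cfun_eq => x; exact: conjcK. Qed.

Lemma Re_cderive v f x : U x ->
  complex.Re (cderive v f x) = 'D_v (fun y => complex.Re (f y)) x.
Proof. by move=> Ux; rewrite /= /cderive_fun asboolT. Qed.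

Lemma Im_cderive v f x : U x ->
  complex.Im (cderive v f x) = 'D_v (fun y => complex.Im (f y)) x.
Proof. by move=> Ux; rewrite /= /cderive_fun asboolT. Qed.

Lemma cderive_out v f x : ~ U x -> cderive v f x = 0.
Proof. by move=> nUx; rewrite /= /cderive_fun asboolF. Qed.

Local Opaque cderive.

Lemma complex_eq (y z : R[i]) :
  complex.Re y = complex.Re z -> complex.Im y = complex.Im z -> y = z.
Proof. by case: y z => a b [c d] /= -> ->. Qed.

Lemma ReD (y z : R[i]) : complex.Re (y + z) = complex.Re y + complex.Re z.
Proof. by case: y z => a b [c d]. Qed.
Lemma ImD (y z : R[i]) : complex.Im (y + z) = complex.Im y + complex.Im z.
Proof. by case: y z => a b [c d]. Qed.
Lemma ReM (y z : R[i]) :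
  complex.Re (y * z) = complex.Re y * complex.Re z - complex.Im y * complex.Im z.
Proof. by case: y z => a b [c d]. Qed.
Lemma ImM (y z : R[i]) :
  complex.Im (y * z) = complex.Re y * complex.Im z + complex.Im y * complex.Re z.
Proof. by case: y z => a b [c d]. Qed.

Lemma cfunD f g x : (f + g) x = f x + g x. Proof. by []. Qed.
Lemma cfunM f g x : (f * g) x = f x * g x. Proof. by []. Qed.

Lemma cderiveD v f g : cderive v (f + g) = cderive v f + cderive v g.
Proof.
apply: cfun_eq => x; rewrite cfunD; have [Ux|nUx] := pselect (U x); last first.
  by rewrite !cderive_out ?addr0.
have [[fr fi] [gr gi]] := (cfun_smooth f, cfun_smooth g).
apply: complex_eq; rewrite (ReD, ImD) !(Re_cderive, Im_cderive) //.
  under [in LHS]eq_fun do rewrite ReD.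
  by apply: deriveD; exact: smooth_derivable Ux.
under [in LHS]eq_fun do rewrite ImD.
by apply: deriveD; exact: smooth_derivable Ux.
Qed.

Lemma cderiveM v f g : cderive v (f * g) = cderive v f * g + f * cderive v g.
Proof.
apply: cfun_eq => x; rewrite cfunD !cfunM; have [Ux|nUx] := pselect (U x); last first.
  by rewrite !cderive_out ?mul0r ?mulr0 ?addr0.
have [[fr fi] [gr gi]] := (cfun_smooth f, cfun_smooth g).
apply: complex_eq; rewrite (ReD, ImD) !(ReM, ImM) !(Re_cderive, Im_cderive) //.
  under [in LHS]eq_fun do rewrite cfunM ReM.
  have := @deriveB _ _ _ (fun y => complex.Re (f y) * complex.Re (g y))
    (fun y => complex.Im (f y) * complex.Im (g y)) x v.
  rewrite !(@smooth_deriveM _ _ U) // => ->; first by ring.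
    by apply: smooth_derivable Ux; exact: smooth_onM.
  by apply: smooth_derivable Ux; exact: smooth_onM.
under [in LHS]eq_fun do rewrite cfunM ImM.
have := @deriveD _ _ _ (fun y => complex.Re (f y) * complex.Im (g y))
  (fun y => complex.Im (f y) * complex.Re (g y)) x v.
rewrite !(@smooth_deriveM _ _ U) // => ->; first by ring.
  by apply: smooth_derivable Ux; exact: smooth_onM.
by apply: smooth_derivable Ux; exact: smooth_onM.
Qed.

Lemma cderiveC u v f : cderive u (cderive v f) = cderive v (cderive u f).
Proof.
apply: cfun_eq => x; have [Ux|nUx] := pselect (U x); last by rewrite !cderive_out.
have [fr fi] := cfun_smooth f.
apply: complex_eq.
  have E a b : 'D_a (fun y => complex.Re (cderive b f y)) x =
      'D_a ('D_b (fun y => complex.Re (f y))) x.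
    by apply: (eq_on_derive oU) => // y Uy; exact: Re_cderive.
  apply: etrans (@Re_cderive u (cderive v f) x Ux) _.
  apply: etrans (E u v) _.
  apply: etrans (schwarz oU u v fr Ux) _.
  apply: etrans (esym (E v u)) _.
  exact: esym (@Re_cderive v (cderive u f) x Ux).
have E a b : 'D_a (fun y => complex.Im (cderive b f y)) x =
    'D_a ('D_b (fun y => complex.Im (f y))) x.
  by apply: (eq_on_derive oU) => // y Uy; exact: Im_cderive.
apply: etrans (@Im_cderive u (cderive v f) x Ux) _.
apply: etrans (E u v) _.
apply: etrans (schwarz oU u v fi Ux) _.
apply: etrans (esym (E v u)) _.
exact: esym (@Im_cderive v (cderive u f) x Ux).
Qed.

Lemma cderive_conj v f : cderive v (cconj f) = cconj (cderive v f).
Proof.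
apply: cfun_eq => x; have [Ux|nUx] := pselect (U x); last first.
  by rewrite cderive_out // -[RHS]/((cderive v f x)^*%C) cderive_out // conjc0.
have [fr fi] := cfun_smooth f.
have RJ (z : R[i]) : complex.Re (z^*%C) = complex.Re z by case: z.
have IJ (z : R[i]) : complex.Im (z^*%C) = - complex.Im z by case: z.
apply: complex_eq; rewrite -[cconj _ x]/((cderive v f x)^*%C).
  by rewrite Re_cderive // RJ Re_cderive //; under [in LHS]eq_fun do rewrite /= RJ.
rewrite Im_cderive // IJ Im_cderive //; under [in LHS]eq_fun do rewrite /= IJ.
by apply: deriveN; exact: smooth_derivable Ux.
Qed.

End SmoothComplex.

Arguments cfun {R V U} o.
Arguments mk_cfun {R V U} oU [f] sf.
Arguments cderive {R V U} [oU] v f.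
Arguments cconj {R V U} [oU] f.
Arguments cfun_smooth {R V U} [oU] f.

(** * Maps to C^2 with orthogonal coordinates *)

(** As [hki] is conjugate to [hik], the factor [hik - hki] is 2 i Im hik; the real part of the right
    side of [d_fs_christoffel] thus becomes the real curvature tensor. *)
Lemma Re_curvature (R : rcfType) (hik hki hjl hjk hil hji hkl a b : R[i]) (gjk gil gji gkl : R) :
  hik^*%C = hki -> complex.Re hjk = gjk -> complex.Re hil = gil ->
  complex.Re hji = gji -> complex.Re hkl = gkl ->
  complex.Re (- (hik - hki) * hjl - hjk * hil + hji * hkl + a - b)
    - (complex.Re a - complex.Re b) =
  2 * complex.Im hik * complex.Im hjl - gjk * gil
  + complex.Im hjk * complex.Im hil + gji * gkl
  - complex.Im hji * complex.Im hkl.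
Proof.
move=> <- <- <- <- <-; case: hik hjl hjk => [r1 i1] [r2 i2] [r3 i3].
by case: hil hji hkl a b => [r4 i4] [r5 i5] [r6 i6] [r7 i7] [r8 i8] /=; ring.
Qed.

Section OrthogonalMap.
Context {R : realType} {V : normedModType R} (U : set V) (oU : open U) (e : 'I_4 -> V).
Local Notation A := (cfun oU).
Local Notation C := R[i].
Context (w : A * A).
Let d k : A -> A := cderive (e k).

Definition sqnorm1 (z : C * C) : R :=
  1 + (complex.Re z.1 ^+ 2 + complex.Im z.1 ^+ 2) + (complex.Re z.2 ^+ 2 + complex.Im z.2 ^+ 2).

Lemma sqnorm1_gt0 z : 0 < sqnorm1 z.
Proof. by rewrite /sqnorm1 -addrA ltr_wpDr ?addr_ge0 ?sqr_ge0. Qed.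

Definition inv_sqnorm1 (z : C * C) : C := ((sqnorm1 z)^-1)%:C%C.

Lemma inv_sqnorm1_smooth : csmooth_on U (fun x => inv_sqnorm1 (w.1 x, w.2 x)).
Proof.
have [[a1 b1] [a2 b2]] := (cfun_smooth w.1, cfun_smooth w.2).
have sq (f : V -> R) : smooth_on U f -> smooth_on U (fun x => f x ^+ 2).
  by move=> sf; apply: (eq_smooth_on oU _ (smooth_onM oU sf sf)) => x _; rewrite expr2.
have sN : smooth_on U (fun x => sqnorm1 (w.1 x, w.2 x)).
  have := smooth_onD oU (smooth_onD oU (smooth_on_cst oU (1 : R))
    (smooth_onD oU (sq _ a1) (sq _ b1))) (smooth_onD oU (sq _ a2) (sq _ b2)).
  by apply: (eq_smooth_on oU) => x _.
split; last exact: (smooth_on_cst oU 0).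
by apply: (smooth_onV oU _ sN) => x _; rewrite gt_eqF ?sqnorm1_gt0.
Qed.

Let t : A := mk_cfun oU inv_sqnorm1_smooth.

Lemma cconj_t : cconj t = t.
Proof. by apply: cfun_eq => x; exact: conjc_real. Qed.

Lemma t_sqnorm : t * (1 + w.1 * cconj w.1 + w.2 * cconj w.2) = 1.
Proof.
apply: cfun_eq => x; have s0 := sqnorm1_gt0 (w.1 x, w.2 x).
transitivity (inv_sqnorm1 (w.1 x, w.2 x) * (1 + w.1 x * (w.1 x)^*%C + w.2 x * (w.2 x)^*%C)) => //.
rewrite -[RHS]/(1 : C) /inv_sqnorm1.
have -> : 1 + w.1 x * (w.1 x)^*%C + w.2 x * (w.2 x)^*%C = (sqnorm1 (w.1 x, w.2 x))%:C%C.
  rewrite /sqnorm1 /=; case: (w.1 x) (w.2 x) => a b [a' b'].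
  by apply: complex_eq => /=; ring.
by move: (sqnorm1 _) s0 => s s0; rewrite -rmorphM mulVf ?gt_eqF.
Qed.

Let W i : A * A := (d i w.1, d i w.2).
Let herm := fs_herm (@cconj _ _ _ oU) w t.
Let T i j := fs_nabla (@cconj _ _ _ oU) d w t i (W j).
Let h i j := herm (W i) (W j).
Let H i j l := herm (T i j) (W l).

(** The formula of [fs_herm] over numbers instead of functions; evaluation at a point turns one into
    the other by conversion. *)
Definition herm_at (z x y : C * C) : C := fs_herm (@conjc R) z (inv_sqnorm1 z) x y.

Definition cval (x : A * A) p : C * C := (x.1 p, x.2 p).
Local Notation z p := (cval w p).
Local Notation Wp m p := (cval (W m) p).

Let hermE (x y : A * A) p : herm x y p = herm_at (z p) (cval x p) (cval y p).
Proof. by []. Qed.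

Context (orth : forall i j p, U p -> i != j -> complex.Re (herm_at (z p) (Wp i p) (Wp j p)) = 0)
  (pos : forall i p, U p -> 0 < complex.Re (herm_at (z p) (Wp i p) (Wp i p)))
  (parseval : forall p (x y : C * C), U p -> complex.Re (herm_at (z p) x y) =
    \sum_m complex.Re (herm_at (z p) x (Wp m p)) * complex.Re (herm_at (z p) y (Wp m p))
            / complex.Re (herm_at (z p) (Wp m p) (Wp m p))).

Let G i p := complex.Re (h i i p).
Let Om i j p := complex.Im (h i j p).
Let Gam i j k p := complex.Re (H i j k p).

Let Re_h i j p : U p -> complex.Re (h i j p) = if i == j then G i p else 0.
Proof. by move=> Up; have [->//|ij] := eqVneq i j; exact: orth. Qed.

Let herm_at_conj q x y : (herm_at q x y)^*%C = herm_at q y x.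
Proof. by apply: (cj_fs_herm (cj := @conjc R)); [exact: conjcK|exact: conjc_real]. Qed.

Let herm_at_i1 q x y : herm_at q ('i%C * x.1, 'i%C * x.2) y = 'i%C * herm_at q x y.
Proof. by rewrite /herm_at /fs_herm /=; ring. Qed.

(** By antilinearity in [y], Omega(x, y) = g(x, J y), which makes the Parseval identity of g
    available for Omega. *)
Let herm_at_i2 q x y :
  complex.Re (herm_at q x ('i%C * y.1, 'i%C * y.2)) = complex.Im (herm_at q x y).
Proof.
rewrite -herm_at_conj herm_at_i1 -[in RHS]herm_at_conj.
by case: (herm_at q y x) => a b /=; ring.
Qed.

Let OmN i j p : U p -> Om j i p = - Om i j p.
Proof.
move=> _; have E : (h i j p)^*%C = h j i p := herm_at_conj (z p) (Wp i p) (Wp j p).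
by rewrite /Om -E; case: (h i j p).
Qed.

Let Im_herm x j p : U p -> complex.Im (herm x (W j) p) =
  \sum_m complex.Re (herm x (W m) p) * Om m j p / G m p.
Proof.
move=> Up; rewrite hermE -herm_at_i2 parseval //; apply: eq_bigr => m _.
congr (_ * _ / _); rewrite herm_at_i1.
rewrite (OmN j m Up) /Om hermE.
by case: herm_at => a b /=; ring.
Qed.

Let dD k : forall x y, d k (x + y) = d k x + d k y := @cderiveD R V U oU (e k).
Let dM k : forall x y, d k (x * y) = d k x * y + x * d k y := @cderiveM R V U oU (e k).
Let dC i j : forall x, d i (d j x) = d j (d i x) := @cderiveC R V U oU (e i) (e j).
Let dJ k : forall x, d k (cconj x) = cconj (d k x) := @cderive_conj R V U oU (e k).

Let d_herm k x y : d k (herm x y) =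
  herm (fs_nabla (@cconj _ _ _ oU) d w t k x) y + herm x (fs_nabla (@cconj _ _ _ oU) d w t k y).
Proof. exact: (d_fs_herm dD dM dJ (@cconjK _ _ _ oU) cconj_t t_sqnorm). Qed.

Let GamC i j k p : Gam i j k p = Gam j i k p.
Proof. by rewrite /Gam /H /T (fs_nablaC _ dC). Qed.

Let d_h i j k p : d k (h i j) p = H k i j p + (H k j i p)^*%C.
Proof. rewrite [in LHS]/h d_herm.
rewrite cfunD; congr (_ + _).
exact: (esym (herm_at_conj (z p) (cval (T k j) p) (Wp i p))). Qed.

Let parseval_fun x y p : U p -> complex.Re (herm x y p) =
  \sum_m complex.Re (herm x (W m) p) * complex.Re (herm y (W m) p) / G m p.
Proof. by move=> Up; rewrite hermE parseval. Qed.

Lemma orthogonal_map_empty : U = set0.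
Proof.
apply: (@no_orthogonal_frame R V U oU e G Om Gam).
- by move=> i; have [] := cfun_smooth (h i i).
- by move=> i j; have [] := cfun_smooth (h i j).
- exact: pos.
- exact: OmN.
- by move=> i j k p Up; exact: GamC.
- move=> i j k p Up; transitivity (complex.Re (d k (h i j) p)).
    by rewrite d_h ReD /Gam; case: (H k j i p).
  rewrite Re_cderive //; have [->//|ij] := eqVneq i j.
  rewrite (eq_on_derive oU (g := cst 0)) ?derive_cst // => q Uq.
  by rewrite Re_h // (negPf ij).
(* J^2 = - 1 enters in the form that J is an isometry: Parseval expands g(J W_i, J W_j). *)
- move=> i j p Up; rewrite -Re_h // hermE.
  have hE a b : herm_at (z p) (Wp a p) (Wp b p) = h a b p by [].
  have := @parseval p ('i%C * (Wp i p).1, 'i%C * (Wp i p).2)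
    ('i%C * (Wp j p).1, 'i%C * (Wp j p).2) Up.
  rewrite herm_at_i2 herm_at_i1 hE (_ : complex.Im _ = complex.Re (h i j p)); last first.
    by case: (h i j p) => a b /=; ring.
  move=> ->; apply: eq_bigr => m _; rewrite !herm_at_i1 !hE; congr (_ * _ / _).
    by rewrite (OmN i m Up) /Om; case: (h i m p) => a b /=; ring.
  by rewrite (OmN j m Up) /Om; case: (h j m p) => a b /=; ring.
- move=> i j k p Up.
  transitivity (complex.Im (d k (h i j) p)); first by rewrite Im_cderive.
  rewrite d_h ImD (_ : complex.Im (_^*%C) = - complex.Im (H k j i p)); last by case: (H k j i p).
  rewrite /H !Im_herm // -sumrB; apply: eq_bigr => m _.
  by rewrite /Gam /H mulrBl.
(* Real part of [d_fs_christoffel]; Parseval turns the pairings of covariant derivatives into sums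
   of products of [Gam]. *)
- move=> i j k l p Up.
  have := d_fs_christoffel dD dM dC dJ (@cconjK _ _ _ oU) cconj_t t_sqnorm i j k l.
  rewrite /= -!/(W _) -!/(T _ _) -!/(herm _ _) -!/(H _ _ _) -!/(h _ _).
  move=> /(congr1 (fun f : A => complex.Re (f p))) H0.
  have ReN (y : C) : complex.Re (- y) = - complex.Re y by case: y.
  transitivity (complex.Re (d k (H i j l) p) - complex.Re (d i (H k j l) p) -
    (complex.Re (herm (T i j) (T k l) p) - complex.Re (herm (T k j) (T i l) p))).
    congr (_ - _ - _); [by rewrite Re_cderive|by rewrite Re_cderive|].
    transitivity (\sum_m Gam i j m p * Gam k l m p / G m p
      - \sum_m Gam k j m p * Gam i l m p / G m p).
      by rewrite -sumrB; apply: eq_bigr => m _; rewrite mulrBl.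
    exact: (esym (congr2 (fun a b : R => a - b)
      (parseval_fun (T i j) (T k l) Up) (parseval_fun (T k j) (T i l) Up))).
  have -> : complex.Re (d k (H i j l) p) - complex.Re (d i (H k j l) p) =
    complex.Re ((d k (H i j l) - d i (H k j l)) p) by rewrite -ReN -ReD.
  move: (complex.Re _) H0 => _ ->.
  change (complex.Re (- (h i k p - h k i p) * h j l p - h j k p * h i l p + h j i p * h k l p +
     herm (T i j) (T k l) p - herm (T k j) (T i l) p)
    - (complex.Re (herm (T i j) (T k l) p) - complex.Re (herm (T k j) (T i l) p)) =
    2 * complex.Im (h i k p) * complex.Im (h j l p) -
    (if j == k then G j p else 0) * (if i == l then G i p else 0) +
    complex.Im (h j k p) * complex.Im (h i l p) +
    (if j == i then G j p else 0) * (if k == l then G k p else 0) -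
    complex.Im (h j i p) * complex.Im (h k l p)).
  exact: (Re_curvature _ _ _ (herm_at_conj (z p) (Wp i p) (Wp k p))
    (Re_h j k Up) (Re_h i l Up) (Re_h j i Up) (Re_h k l Up)).
Qed.

End OrthogonalMap.

(** * Affine charts of the projective space *)

Section ProjectiveCharts.
Local Open Scope quotient_scope.
Context {R : realType} {n : nat}.
Local Notation C := (Cplx R).
Local Notation CP := (CP R n).

Lemma complexifyK (w : 'rV[C]_n) : complexify (realify w) = w.
Proof.
apply/rowP => j; rewrite /complexify /realify mxE row_mxKl row_mxKr !mxE.
by case: (w 0 j).
Qed.

Lemma hcoord_neq0 (p : CP) : hcoord p != 0.
Proof. by rewrite /hcoord; case: (repr p) => z zP; have := set_mem zP. Qed.

Lemma affine_cover (p : CP) : exists k, chart_dom (affine_chart R k) p.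
Proof.
have := hcoord_neq0 p; apply: contraNP => /forallNP H.
apply/eqP/rowP => k; rewrite mxE; apply/eqP; apply: contrapT => /negP h.
exact: (H k).
Qed.

Lemma affine_chartK (k : 'I_n.+1) (p : CP) : chart_dom (affine_chart R k) p ->
  chart_inv (affine_chart R k) (chart_map (affine_chart R k) p) = p.
Proof.
move=> /= pk; rewrite complexifyK -[RHS]reprK.
apply/eqmodP => /=; apply/asboolP; exists (hcoord p 0 k)^-1; first by rewrite invr_eq0.
apply/rowP => j; rewrite !mxE /=; case: unliftP => [i ->|->] /=.
  by rewrite !mxE mulrC.
by rewrite -[set_val (repr p)]/(hcoord p) mulVf.
Qed.

(** Openness in the quotient is tested on preimages, and nonvanishing of the [k]-th entry does not
    depend on the representative. *)
Lemma open_affine (k : 'I_n.+1) : open (chart_dom (affine_chart R k)).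
Proof.
pose f (z : nonzero_vec R n) : C := set_val z 0 k.
have cf : continuous f.
  move=> z; apply: (@continuous_comp _ _ _ (set_val : nonzero_vec R n -> _)
    (fun M : 'rV[C]_n.+1 => M 0 k)).
    exact: initial_continuous.
  exact: coord_continuous.
have E : \pi_CP @^-1` chart_dom (affine_chart R k) = f @^-1` [set c : C | c != 0].
  apply/seteqP; split => z /=; rewrite /f /hcoord;
  have /eqmodP /= /asboolP [l l0 lE] : repr (\pi_CP z) = z %[mod CP] by rewrite reprK.
    by rewrite lE mxE mulf_eq0 negb_or => /andP[].
  by rewrite lE mxE mulf_eq0 negb_or l0.
rewrite /open /= /quotient_open E.
apply: open_comp; first by move=> z _; exact: cf.
rewrite (_ : [set c : C | c != 0] = ~` [set 0]); last by apply/seteqP; split=> c /= /eqP.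
apply: closed_openC; apply: accessible_closed_set1; apply: hausdorff_accessible.
exact: norm_hausdorff.
Qed.

End ProjectiveCharts.

(** * Transition domains, Jacobians and orthogonal bases *)

(** The image consists of the points of [chart_im x] that [chart_inv x] sends into [D], and
    [chart_inv x] is continuous on the open set [chart_im x]. *)
Lemma open_transition_domain (R : realType) m (M : topologicalType) (x : chart R m M) (D : set M) :
  is_chart x -> open D -> open (chart_map x @` (chart_dom x `&` D)).
Proof.
move=> [od oi xK _ ci] oD; rewrite openE => y [p [xp Dp] <-].
have Iy : chart_im x (chart_map x p) by exists p.
have cy : {for chart_map x p, continuous (chart_inv x)}.
  by move: ci; rewrite continuous_open_subspace // => /(_ (chart_map x p)); apply; rewrite inE.
have nI : \forall y \near chart_map x p, chart_im x y by exact: open_nbhs_nbhs.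
have nD : \forall y \near chart_map x p, D (chart_inv x y).
  by apply: cy; rewrite xK ?inE //; exact: open_nbhs_nbhs.
apply: filterS2 nI nD => _ [q xq <-]; rewrite xK ?inE // => Dq.
by exists q.
Qed.

(** Chain rule for [G \o F], the identity near [y]; as vectors are rows, the Jacobian of [F] stands
    on the left. *)
Lemma jacobian_unit (R : realType) m (F G : 'rV[R]_m -> 'rV[R]_m) (y : 'rV[R]_m) :
  differentiable F y -> differentiable G (F y) -> (\forall z \near y, G (F z) = z) ->
  jacobian F y \in unitmx.
Proof.
move=> dF dG GF.
have E : jacobian F y *m jacobian G (F y) = 1%:M.
  apply/row_matrixP => i; rewrite row_mul !rowE mulmx1.
  rewrite /jacobian !mul_rV_lin1 /=.
  have := diff_comp dF dG => /(congr1 (fun f => f (delta_mx 0 i))) /= <-.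
  rewrite -deriveE; last exact: differentiable_comp.
  have -> : 'D_(delta_mx 0 i) (G \o F) y = 'D_(delta_mx 0 i) (@id 'rV[R]_m) y.
    by apply: near_eq_derive; exact: GF.
  by rewrite derive_id.
exact: (mulmx1_unit E).1.
Qed.

Lemma row_unit_neq0 (F : fieldType) n (J : 'M[F]_n) m : J \in unitmx -> row m J != 0.
Proof.
move=> uJ; apply/eqP => r0.
have := congr1 (mulmx ^~ (invmx J)) r0; rewrite /= -row_mul mulmxV // mul0mx.
by move/rowP/(_ m); rewrite !mxE eqxx => /eqP; rewrite oner_eq0.
Qed.

(** Parseval: by orthogonality, pairing with [row m J] isolates the [m]-th coordinate of [u] in the
    basis formed by the rows of [J]. *)
Lemma bilinear_expansion (F : fieldType) n (B : 'rV[F]_n -> 'rV[F]_n -> F) (J : 'M[F]_n) :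
  (forall a u v y, B (a *: u + v) y = a * B u y + B v y) -> (forall u v, B u v = B v u) ->
  J \in unitmx -> (forall i j, i != j -> B (row i J) (row j J) = 0) ->
  (forall i, B (row i J) (row i J) != 0) ->
  forall u v, B u v = \sum_m B u (row m J) * B v (row m J) / B (row m J) (row m J).
Proof.
move=> BL BC uJ orth g0 u v.
have B0 y : B 0 y = 0.
  have := BL 1 0 0 y; rewrite scaler0 addr0 mul1r => /eqP.
  by rewrite eq_sym -subr_eq0 addrK => /eqP.
pose c := u *m invmx J.
have uE : u = \sum_m c 0 m *: row m J by rewrite -mulmx_sum_row mulmxKV.
have BE y : B u y = \sum_m c 0 m * B (row m J) y.
  rewrite {1}uE; elim/big_rec2: _ => [|m a b _ E]; first exact: B0.
  by rewrite BL E.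
rewrite BE; apply: eq_bigr => m _.
rewrite BE (bigD1 m) //= big1 ?addr0; last by move=> k km; rewrite orth ?mulr0.
by rewrite [B v _]BC mulrAC mulfK.
Qed.

(** * The Fubini-Study metric in an affine chart *)

Section Hermitian.
Context {R : realType}.
Local Notation C := R[i].
Implicit Types (z x y : C * C).

Lemma Re_herm_atC z x y : complex.Re (herm_at z x y) = complex.Re (herm_at z y x).
Proof.
have -> : herm_at z y x = (herm_at z x y)^*%C.
  by apply/esym; apply: (cj_fs_herm (cj := @conjc R)); [exact: conjcK|exact: conjc_real].
by case: (herm_at z x y).
Qed.

Lemma Re_herm_at_gt0 z x : x != 0 -> 0 < complex.Re (herm_at z x x).
Proof.
case: z x => [[a1 b1] [a2 b2]] [[x1 y1] [x2 y2]] x0.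
have := sqnorm1_gt0 ((a1 +i* b1)%C, (a2 +i* b2)%C); rewrite /herm_at /inv_sqnorm1.
set s := sqnorm1 _ => s0; have sn := lt0r_neq0 s0.
(* Lagrange's identity: (1 + |z|^2) |x|^2 - |<x, z>|^2 = |x|^2 + |x_1 z_2 - x_2 z_1|^2. *)
have -> : complex.Re (fs_herm (@conjc R) ((a1 +i* b1)%C, (a2 +i* b2)%C) (s^-1)%:C%C
    ((x1 +i* y1)%C, (x2 +i* y2)%C) ((x1 +i* y1)%C, (x2 +i* y2)%C)) =
  (x1 ^+ 2 + y1 ^+ 2 + (x2 ^+ 2 + y2 ^+ 2)
   + ((x1 * a2 - y1 * b2 - x2 * a1 + y2 * b1) ^+ 2
    + (x1 * b2 + y1 * a2 - x2 * b1 - y2 * a1) ^+ 2)) / s ^+ 2.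
  rewrite /fs_herm /s /sqnorm1 /= in sn *; field; exact: sn.
rewrite divr_gt0 ?exprn_gt0 // ltr_wpDr ?addr_ge0 ?sqr_ge0 // lt_neqAle eq_sym.
rewrite !addr_ge0 ?sqr_ge0 // andbT; apply: contra x0.
rewrite !paddr_eq0 ?addr_ge0 ?sqr_ge0 // !sqrf_eq0.
move=> /andP[/andP[/eqP-> /eqP->] /andP[/eqP-> /eqP->]].
by [].
Qed.

(** Follows the layout of [realify]: real parts in the first half of the row, imaginary parts in the
    second. *)
Definition cpair (u : 'rV[R]_(2 + 2)) : C * C :=
  ((u 0 (lshift 2 0) +i* u 0 (rshift 2 0))%C, (u 0 (lshift 2 1) +i* u 0 (rshift 2 1))%C).

Lemma cpair_surj x : exists u, x = cpair u.
Proof.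
exists (row_mx (\row_j if j == 0 then complex.Re x.1 else complex.Re x.2)
               (\row_j if j == 0 then complex.Im x.1 else complex.Im x.2)).
by rewrite /cpair !row_mxEl !row_mxEr !mxE /=; case: x => [[a b] [a' b']].
Qed.

Lemma cpair_eq0 u : cpair u = 0 -> u = 0.
Proof.
move=> [h1 h2 h3 h4]; apply/rowP => j; rewrite mxE.
have I2 (k : 'I_2) : k = 0 \/ k = 1.
  by case: k => [[|[|//]] lt]; [left|right]; exact/val_inj.
by case: (split_ordP j) => k ->; case: (I2 k) => ->.
Qed.

Lemma Re_herm_at_row_gt0 z (J : 'M[R]_(2 + 2)) m : J \in unitmx ->
  0 < complex.Re (herm_at z (cpair (row m J)) (cpair (row m J))).
Proof.
move=> /(row_unit_neq0 m) r0; apply: Re_herm_at_gt0; apply: contra r0 => /eqP r0.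
by apply/eqP; exact: cpair_eq0.
Qed.

Lemma Re_herm_at_linear z a u v y :
  complex.Re (herm_at z (cpair (a *: u + v)) y) =
  a * complex.Re (herm_at z (cpair u) y) + complex.Re (herm_at z (cpair v) y).
Proof.
rewrite /herm_at /fs_herm /cpair !mxE /=.
case: z y => [[a1 b1] [a2 b2]] [[x1 y1] [x2 y2]] /=; ring.
Qed.

Lemma herm_at_parseval z (J : 'M[R]_(2 + 2)) : J \in unitmx ->
  (forall i j, i != j -> complex.Re (herm_at z (cpair (row i J)) (cpair (row j J))) = 0) ->
  forall x y, complex.Re (herm_at z x y) =
    \sum_m complex.Re (herm_at z x (cpair (row m J))) * complex.Re (herm_at z y (cpair (row m J)))
            / complex.Re (herm_at z (cpair (row m J)) (cpair (row m J))).
Proof.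
move=> uJ orth x y; have [u ->] := cpair_surj x; have [v ->] := cpair_surj y.
apply: (@bilinear_expansion _ _ (fun u v => complex.Re (herm_at z (cpair u) (cpair v)))) => //.
- by move=> a u1 u2 v1; exact: Re_herm_at_linear.
- by move=> u1 v1; exact: Re_herm_atC.
- by move=> m; rewrite gt_eqF //; exact: Re_herm_at_row_gt0.
Qed.

End Hermitian.

(** * The quotient metric of the Hopf fibration in affine coordinates *)

Section FubiniStudy.
Context {R : realType}.
Local Notation C := (Cplx R).

Lemma hdot_insert n (k : 'I_n.+1) (a b : C) (u v : 'rV[C]_n) :
  hdot (insert_entry k a u) (insert_entry k b v) =
  a * b^* + \sum_j u 0 j * (v 0 j)^*.
Proof.
rewrite /hdot (bigD1_ord k) //= !mxE unlift_none /=; congr (_ + _).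
by apply: eq_bigr => j _; rewrite !mxE liftK.
Qed.

Lemma hdot_horizontal n (z u v : 'rV[C]_n.+1) : hdot z z != 0 ->
  hdot (horizontal z u) (horizontal z v) = hdot u v - hdot u z * hdot z v / hdot z z.
Proof.
move=> z0.
have hJ x y : (hdot x y)^* = hdot y x.
  rewrite /hdot rmorph_sum; apply: eq_bigr => j _.
  by rewrite rmorphM /= conjCK mulrC.
have hL (x y t : 'rV[C]_n.+1) a : hdot (x - a *: y) t = hdot x t - a * hdot y t.
  by rewrite /hdot mulr_sumr -sumrB; apply: eq_bigr => j _; rewrite !mxE mulrBl mulrA.
have hR (x y t : 'rV[C]_n.+1) a : hdot t (x - a *: y) = hdot t x - a^* * hdot t y.
  by rewrite -hJ hL rmorphB rmorphM /= !hJ.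
rewrite /horizontal !hL !hR rmorphM fmorphV /= !hJ.
by field.
Qed.

Lemma hdot_insert_complexify (k : 'I_3) (a b : C) (u v : 'rV[R]_(2 + 2)) :
  hdot (insert_entry k a (complexify u)) (insert_entry k b (complexify v)) =
  a * b^* + ((cpair u).1 * (cpair v).1^* + (cpair u).2 * (cpair v).2^*).
Proof.
rewrite hdot_insert big_ord_recl big_ord1.
have -> : lift ord0 ord0 = 1 :> 'I_2 by exact/val_inj.
by rewrite !mxE.
Qed.

(** For z = (1, w), [hdot z z] is 1 + |w|^2, and tangent vectors have entry 0 at [k];
    [hdot_horizontal] then becomes [fs_herm] with t = 1 / (1 + |w|^2). *)
Lemma fubini_studyE (c : R) (k : 'I_3) (p : CP R 2) u v :
  fubini_study c k p u v =
  4 / c * complex.Re (herm_at (cpair (chart_map (affine_chart R k) p)) (cpair u) (cpair v)).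
Proof.
rewrite /fubini_study /hopf_metric; congr (_ * complex.Re _).
move: (chart_map _ p) => y.
have E : hdot (insert_entry k 1 (complexify y)) (insert_entry k 1 (complexify y)) =
    (sqnorm1 (cpair y))%:C%C.
  rewrite hdot_insert_complexify rmorph1 mulr1 /sqnorm1 /cpair /=.
  by apply: complex_eq => /=; ring.
have s0 : (sqnorm1 (cpair y))%:C%C != 0 :> C.
  by rewrite -[0]/((0 : R)%:C%C : C) (inj_eq (@complexI R)) gt_eqF ?sqnorm1_gt0.
rewrite hdot_horizontal E //.
rewrite !hdot_insert_complexify /herm_at /fs_herm /inv_sqnorm1.
rewrite rmorph0 rmorph1 !mulr0 !mul0r !add0r.
move: (sqnorm1 _) s0 => s s0.
have -> : ((s^-1)%:C%C : C) = (s%:C%C)^-1 by rewrite fmorphV.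
move: (s%:C%C : C) s0 => t t0.
have K (a b d : C) : (a - b * d / t) / t = t^-1 * a - t^-1 ^+ 2 * b * d by field.
exact: K.
Qed.

End FubiniStudy.

(** * Orthogonal coordinates as a map into an affine chart *)

Section SmoothMap.
Context {R : realType} {U : set 'rV[R]_(2 + 2)} (oU : open U)
  (F : 'rV[R]_(2 + 2) -> 'rV[R]_(2 + 2)) (sF : smooth_on U F).

Lemma cpair1_smooth : csmooth_on U (fun y => (cpair (F y)).1).
Proof. by split; exact: smooth_on_coord. Qed.

Lemma cpair2_smooth : csmooth_on U (fun y => (cpair (F y)).2).
Proof. by split; exact: smooth_on_coord. Qed.

Definition cpair_cfun : cfun oU * cfun oU :=
  (mk_cfun oU cpair1_smooth, mk_cfun oU cpair2_smooth).

Lemma cval_cderive v y : U y ->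
  cval (cderive v cpair_cfun.1, cderive v cpair_cfun.2) y = cpair ('D_v F y).
Proof.
move=> Uy; have dF : derivable F y v by exact: smooth_derivable Uy.
have E j : 'D_v (fun z => F z 0 j) y = 'D_v F y 0 j by rewrite derive_mx // mxE.
rewrite /cval /cpair -!E; congr pair; apply: complex_eq.
- exact: Re_cderive.
- exact: Im_cderive.
- exact: Re_cderive.
- exact: Im_cderive.
Qed.

(** The rows of the Jacobian are the coordinate vectors; its invertibility makes them nonzero, so
    that the [G] are positive, and a basis, so that Parseval holds. *)
Lemma no_orthogonal_map :
  (forall y, U y -> jacobian F y \in unitmx) ->
  (forall i j y, U y -> i != j -> complex.Re (herm_at (cpair (F y))
     (cpair ('D_(delta_mx 0 i) F y)) (cpair ('D_(delta_mx 0 j) F y))) = 0) ->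
  U = set0.
Proof.
move=> uJ orth.
have rowJ i y : U y -> row i (jacobian F y) = 'D_(delta_mx 0 i) F y.
  by move=> Uy; rewrite rowE deriveEjacobian //; have [+ _] := sF 1; exact.
apply: (@orthogonal_map_empty R _ U oU (fun i : 'I_4 => delta_mx 0 (i : 'I_(2 + 2))) cpair_cfun).
- by move=> i j y Uy ij; rewrite !cval_cderive //; exact: orth.
- move=> i y Uy; rewrite !cval_cderive // -rowJ //.
  by apply: Re_herm_at_row_gt0; exact: uJ.
- move=> y a b Uy; have -> := @herm_at_parseval R (cpair (F y)) (jacobian F y) (uJ y Uy) _ a b.
    by apply: eq_bigr => m _; rewrite !cval_cderive // rowJ.
  by move=> i j ij; rewrite !rowJ //; exact: orth.
Qed.

End SmoothMap.

Theorem proposition3p2 (R : realType) (c : R) (hc : 0 < c)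
    (U : set (CP R 2)) (openU : open U) (U_nonempty : U !=set0) :
  ~ exists x : chart R (2 + 2) (CP R 2),
      chart_dom x = U /\
      orthogonal_coordinates (@affine_chart R 2) (@fubini_study R 2 c) x.
Proof.
move=> [x [dx [[cx sx] orth]]]; have [p Up] := U_nonempty.
have [k pk] := affine_cover p.
have [sF sG] := sx k.
have [_ _ xK _ _] := cx.
(* [F] is the transition map from the given coordinates to an affine chart around [p]. Its domain
   [V] contains the image of [p], so emptiness of [V] is a contradiction. *)
pose a := affine_chart R k; pose F := chart_map a \o chart_inv x.
pose V := chart_map x @` (chart_dom x `&` chart_dom a).
have oV : open V by apply: open_transition_domain => //; exact: open_affine.
suff : V = set0.
  by move=> /seteqP[+ _] => /(_ (chart_map x p)); apply; exists p => //; split=> //; rewrite dx.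
have FK q : chart_dom x q -> F (chart_map x q) = chart_map a q.
  by move=> xq; rewrite /F /= xK ?inE.
apply: (no_orthogonal_map oV sF).
  (* The smooth inverse transition map makes the Jacobian of [F] invertible. *)
  move=> y Vy; apply: (@jacobian_unit _ _ _ (chart_map x \o chart_inv a)).
  - by have [+ _] := sF 1%N; exact.
  - have [+ _] := sG 1%N; apply; move: Vy => [q [xq aq] <-]; exists q => //.
    by rewrite -/F FK.
  - apply: near_on oV _ _ _ Vy => _ [q [xq aq] <-].
    by rewrite -/F FK //; exact: (congr1 (chart_map x) (affine_chartK aq)).
move=> i j _ [q [xq aq] <-] ij.
have := orth k q xq aq i j ij; rewrite fubini_studyE => /eqP.
(* The factor 4 / c is nonzero, so orthogonality passes to the real part of [herm_at]. *)
rewrite mulf_eq0 mulf_eq0 invr_eq0 pnatr_eq0 (gt_eqF hc) /= => /eqP E.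
pose W i := coord_vector (@affine_chart R 2) k x i q.
exact: etrans (congr1 (fun z => complex.Re (herm_at (cpair z) (cpair (W i)) (cpair (W j))))
  (FK q xq)) E.
Qed.
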